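(* Let $\mathbf M$ be a matroid on a finite set $S$ with representation $\phi:U\to W$ over a field $\Bbbk$, and let $A\subseteq S$ be a T-flat of $\mathbf M$. Then $$\dim_{\Bbbk} T_A(\phi)=\beta\big((\mathbf M|A)^*\big),$$ where $T_A(\phi)$ is the T-space of $A$ and $\beta$ is Crapo's beta invariant.
   Context: Setting: $\Bbbk$ is a field, $U,W$ are finite dimensional $\Bbbk$-vector spaces, $U$ has a basis $\{e_i\mid i\in S\}$, and $\phi:U\to W$ is linear. The matroid $\mathbf M$ on $S$ represented by $\phi$ has as independent sets those $I\subseteq S$ for which the vectors $\phi(e_i)$, $i\in I$, are linearly independent. For $I\subseteq S$ let $U_I=\mathrm{span}\{e_i\mid i\in I\}$, $V_I=\mathrm{span}\{\phi(e_i)\mid i\in I\}$, $r(I)=\dim V_I$ (the rank) and $l(I)=|I|-r(I)-1$ (the level). A T-flat is a non-empty union of circuits of $\mathbf M$. $\mathbf M|A$ is the restriction of $\mathbf M$ to $A$, and $^*$ denotes the dual matroid. Multiplicity space: if $A$ is a T-flat of level $l=l(A)$, then $S_A(\phi)\subseteq \mathrm{Sym}^{l}(V_A)$ is the linear span of all products $w_1w_2\cdots w_l$ with $w_i\in V_{J_i\setminus J_{i-1}}\cap V_{J_{i-1}}$, where $J_0\subset J_1\subset\cdots\subset J_l=A$ ranges over all chains of T-flats with $l(J_i)=i$. (For $l=0$, i.e. $A$ a circuit, $S_A(\phi)=\Bbbk$, spanned by the empty product.) If $A$ is not a T-flat, $S_A(\phi)=0$. T-space: $T_A(\phi)=S_A(\phi)^*\otimes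 \bigwedge^{|A|}U_A\otimes\bigwedge^{r(A)}V_A^*$, where $^*$ on vector spaces denotes the $\Bbbk$-dual. Beta invariant: for a matroid $N$ on a finite set $E$ with rank function $r_N$ and lattice of flats $\mathfrak L(N)$ (ordered by inclusion, with least element $0$ and M\''obius function $\mu$), $\beta(N)=(-1)^{r_N(E)}\sum_{x\in\mathfrak L(N)}\mu(0,x)\,r_N(x)$. *)

(* Defs.v *)
From HB Require Import structures.
From Stdlib Require Import Classical ClassicalEpsilon.
From mathcomp Require Import all_boot all_order all_algebra.
From mathcomp.multinomials Require Import mpoly.

Set Implicit Arguments.
Unset Strict Implicit.
Unset Printing Implicit Defensive.

Import GRing.Theory.
Local Open Scope ring_scope.

(* The ground set is a subset of the finite type [T], so that restrictions of
   a matroid stay over the same type. *)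
Record matroid (T : finType) := Matroid {
  ground : {set T};
  indep : pred {set T};
  indep_ground : forall I : {set T}, indep I -> I \subset ground;
  indep_set0 : indep set0;
  indep_sub : forall I J : {set T}, I \subset J -> indep J -> indep I;
  indep_aug : forall I J : {set T}, indep I -> indep J -> (#|I| < #|J|)%N ->
    exists2 x, x \in J :\: I & indep (x |: I) }.

Section MatroidTheory.
Context {T : finType}.
Implicit Types (M : matroid T) (I J X Y Z : {set T}) (L : {set {set T}}).

Definition rank M X : nat :=
  (\max_(I : {set T} | indep M I && (I \subset X)) #|I|)%N.

Definition basis M I : bool :=
  indep M I && [forall J : {set T}, indep M J ==> (I \subset J) ==> (J == I)].

Definition circuit M X : bool :=
  [&& X \subset ground M, ~~ indep M X
    & [forall J : {set T}, (J \proper X) ==> indep M J]].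

(* Circuits are non-empty, so a union of circuits is non-empty iff it is the
   union of a non-empty family of circuits. *)
Definition tflat M X : bool :=
  (X != set0) &&
  [exists P : {set {set T}}, [forall C in P, circuit M C] && (X == cover P)].

Lemma basis_ext M I X : indep M I -> I \subset X ->
  exists J : {set T}, [/\ I \subset J, J \subset X, indep M J
    & forall K : {set T}, indep M K -> K \subset X -> (#|K| <= #|J|)%N].
Proof.
move=> iI sIX.
pose Q (J : {set T}) := [&& indep M J, I \subset J & J \subset X].
have QI : Q I by rewrite /Q iI subxx sIX.
case: (arg_maxnP (fun J : {set T} => #|J|) QI) => J /and3P[iJ sIJ sJX] maxJ.
exists J; split=> // K iK sKX; rewrite leqNgt; apply/negP => ltJK.
have [x /setDP[xK xJ] ixJ] := indep_aug iJ iK ltJK.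
have := maxJ (x |: J); rewrite /Q ixJ (subset_trans sIJ (subsetUr _ _)) /=.
rewrite subUset sub1set (subsetP sKX x xK) sJX => /(_ isT).
by rewrite /= cardsU1 xJ add1n ltnn.
Qed.

Lemma basisP M I : reflect (indep M I /\
    (forall K : {set T}, indep M K -> (#|K| <= #|I|)%N)) (basis M I).
Proof.
apply: (iffP andP) => -[iI H]; split=> //.
  have [J [sIJ _ iJ maxJ]] := basis_ext iI (indep_ground iI).
  have := forallP H J; rewrite iJ sIJ => /eqP JI K iK.
  by rewrite -JI; apply: maxJ iK (indep_ground iK).
apply/forallP => J; apply/implyP => iJ; apply/implyP => sIJ.
by rewrite eq_sym eqEcard sIJ H.
Qed.

Section Restrict.
Variables (M : matroid T) (A : {set T}).

Let rindep I := indep M I && (I \subset A).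

Let rindep_ground I : rindep I -> I \subset ground M :&: A.
Proof. by move=> /andP[iI sI]; rewrite subsetI (indep_ground iI). Qed.

Let rindep_set0 : rindep set0.
Proof. by rewrite /rindep indep_set0 sub0set. Qed.

Let rindep_sub I J : I \subset J -> rindep J -> rindep I.
Proof.
move=> sIJ /andP[iJ sJ].
by rewrite /rindep (indep_sub sIJ iJ) (subset_trans sIJ sJ).
Qed.

Let rindep_aug I J : rindep I -> rindep J -> (#|I| < #|J|)%N ->
  exists2 x, x \in J :\: I & rindep (x |: I).
Proof.
move=> /andP[iI sI] /andP[iJ sJ] lt.
have [x xJI ix] := indep_aug iI iJ lt; exists x => //.
rewrite /rindep ix subUset sub1set sI andbT /=.
by case/setDP: xJI => /(subsetP sJ).
Qed.

Definition restrict : matroid T :=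
  Matroid rindep_ground rindep_set0 rindep_sub rindep_aug.

End Restrict.

Section Dual.
Variable M : matroid T.

Let dindep I :=
  (I \subset ground M) && [exists B : {set T}, basis M B && [disjoint I & B]].

Let dindep_ground I : dindep I -> I \subset ground M.
Proof. by case/andP. Qed.

Let dindep_sub I J : I \subset J -> dindep J -> dindep I.
Proof.
move=> sIJ /andP[sJ /existsP[B /andP[bB dJB]]].
rewrite /dindep (subset_trans sIJ sJ); apply/existsP; exists B.
by rewrite bB (disjointWl sIJ dJB).
Qed.

Let dindep_set0 : dindep set0.
Proof.
have [B [_ _ iB maxB]] := basis_ext (indep_set0 M) (sub0set (ground M)).
rewrite /dindep sub0set; apply/existsP; exists B; rewrite -?setI_eq0 ?set0I ?eqxx ?andbT //.
  apply/basisP; split=> // K iK; exact: maxB (indep_ground iK).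
Qed.

Let dindep_aug I J : dindep I -> dindep J -> (#|I| < #|J|)%N ->
  exists2 x, x \in J :\: I & dindep (x |: I).
Proof.
move=> /andP[sI /existsP[BI /andP[/basisP[iBI mBI] dI]]].
move=> /andP[sJ /existsP[BJ /andP[/basisP[iBJ mBJ] dJ]]] ltIJ.
have sBJ : BJ :\: I \subset ground M :\: I by rewrite setSD // indep_ground.
have [B [sB sBE iB maxB]] :=
  basis_ext (indep_sub (subsetDl BJ I) iBJ) sBJ.
have sBI : BI \subset ground M :\: I.
  by rewrite subsetD indep_ground // disjoint_sym.
have bB : basis M B.
  apply/basisP; split=> // K iK; exact: leq_trans (mBI K iK) (maxB _ iBI sBI).
have dIB : [disjoint I & B].
  by rewrite disjoint_sym; move: sBE; rewrite subsetD => /andP[].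
case: (boolP (J :\: I \subset B)) => [sJB | /subsetPn[x xJI xB]]; last first.
  exists x => //; rewrite /dindep subUset sub1set sI andbT.
  case/setDP: (xJI) => xJ _; rewrite (subsetP sJ) //=.
  apply/existsP; exists B; by rewrite bB -setI_eq0 setIUl setU_eq0 !setI_eq0 disjoints1 xB.
exfalso.
have dd : [disjoint BJ :\: I & J :\: I].
  apply: disjointWl (subsetDl _ _) _; apply: disjointWr (subsetDl _ _) _.
  by rewrite disjoint_sym.
have := mBJ B iB; apply/negP; rewrite -ltnNge.
have sU : (BJ :\: I) :|: (J :\: I) \subset B by rewrite subUset sB sJB.
apply: leq_trans (subset_leq_card sU).
rewrite cardsU (disjoint_setI0 dd) cards0 subn0 -(cardsID I BJ) addnC.
rewrite ltn_add2l.
have h : (#|BJ :&: I| <= #|I :\: J|)%N.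
  apply: subset_leq_card; apply/subsetP => x; rewrite !inE => /andP[xB ->].
  by rewrite andbT; apply/negP => xJ; have := disjointFr dJ xJ; rewrite xB.
apply: leq_ltn_trans h _.
by rewrite -(ltn_add2l #|I :&: J|) cardsID [I :&: J]setIC cardsID.
Qed.

Definition dual : matroid T :=
  Matroid dindep_ground dindep_set0 dindep_sub dindep_aug.

End Dual.

Definition flat M X : bool :=
  (X \subset ground M) &&
  [forall x in ground M :\: X, (rank M X < rank M (x |: X))%N].

Definition flats M : {set {set T}} := [set X | flat M X].

(* The Moebius function of a family of sets ordered by inclusion; the first
   argument bounds the recursion depth. *)
Fixpoint mobius_rec (n : nat) L X Y : int :=
  if n is n'.+1 then
    if X == Y then 1
    else - \sum_(Z in L | (X \subset Z) && (Z \proper Y)) mobius_rec n' L X Z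
  else 0.

Definition mobius L X Y : int := mobius_rec #|Y|.+1 L X Y.

Lemma mobius_recE n L X Y : (#|Y| < n)%N ->
  mobius_rec n L X Y = mobius L X Y.
Proof.
suff H m : (#|Y| < n)%N -> (#|Y| < m)%N ->
    mobius_rec n L X Y = mobius_rec m L X Y by move=> ltn; apply: H.
elim: n m Y => [|n IH] [|m] Y //= ltn ltm; case: eqP => // _.
congr (- _); apply: eq_bigr => Z /and3P[_ _ /proper_card ltZ].
by apply: IH; [apply: leq_trans ltZ _ | apply: leq_trans ltZ _].
Qed.

Lemma mobius_refl L X : mobius L X X = 1.
Proof. by rewrite /mobius /= eqxx. Qed.

Lemma mobius_sum L X Y : Y \in L -> X \proper Y ->
  \sum_(Z in L | (X \subset Z) && (Z \subset Y)) mobius L X Z = 0.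
Proof.
move=> YL prXY; rewrite (bigD1 Y) /=; last by rewrite YL subxx proper_sub.
rewrite {1}/mobius /= ifN; last by rewrite proper_neq.
rewrite addrC -[X in X + _]opprK -opprD -[RHS]oppr0; congr (- _).
apply/eqP; rewrite addrC subr_eq0; apply/eqP/eq_big => [Z|Z].
  by rewrite properEneq; case: (Z \in L); case: (X \subset Z);
     rewrite ?andbT ?andbF //= andbC.
by move=> /and3P[_ _ /proper_card lt]; apply: mobius_recE.
Qed.

(* [\bigcap_(Y in flats M) Y] is the least element of the lattice of flats. *)
Definition beta M : int :=
  (-1) ^+ rank M (ground M) *
  \sum_(X in flats M) mobius (flats M) (\bigcap_(Y in flats M) Y) X
                      * (rank M X)%:Z.

End MatroidTheory.

Section LinearSpan.
Context {k : fieldType} {V : vectType k}.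
Implicit Type P : V -> Prop.

Lemma linspan_ex P : exists X : {vspace V}, forall v,
  v \in X <-> exists s : seq V, (forall x, x \in s -> P x) /\ v \in <<s>>%VS.
Proof.
suff [s [Ps maxs]] : exists s : seq V,
    (forall x, x \in s -> P x) /\ (forall x, P x -> x \in <<s>>%VS).
  exists <<s>>%VS => v; split=> [vs|[s' [Ps' vs']]]; first by exists s.
  apply: (subvP _ v vs'); apply/span_subvP => x /Ps'; exact: maxs.
suff H n s : (forall x, x \in s -> P x) -> free s -> (dim V - size s < n)%N ->
    exists s : seq V,
      (forall x, x \in s -> P x) /\ (forall x, P x -> x \in <<s>>%VS).
  by apply: (H (dim V).+1 [::]); rewrite ?nil_free //= ltnS leq_subr.
elim: n s => // n IH s Ps fs ltn.
have [maxs|] := classic (forall x, P x -> x \in <<s>>%VS); first by exists s.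
move=> N; have [x hx] := not_all_ex_not _ _ N.
have [Px /negP xs] := imply_to_and _ _ hx.
have fxs : free (x :: s) by rewrite free_cons xs fs.
apply: (IH (x :: s)) => //.
  by move=> y; rewrite inE => /predU1P[-> //|/Ps].
have : (size (x :: s) <= dim V)%N.
  by rewrite -(eqP fxs) -dimvf dimvS ?subvf.
move: ltn => /=; rewrite ltnS => le_n lt_s.
by apply: leq_trans le_n; rewrite subnS prednK // subn_gt0.
Qed.

(* The linear span of an arbitrary, possibly infinite, set of vectors. *)
Definition linspan P : {vspace V} :=
  proj1_sig (constructive_indefinite_description _ (linspan_ex P)).

Lemma linspanP P v : v \in linspan P <->
  exists s : seq V, (forall x, x \in s -> P x) /\ v \in <<s>>%VS.
Proof. exact: (proj2_sig (constructive_indefinite_description _ (linspan_ex P)) v). Qed.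

End LinearSpan.

Section MultilinearAlgebra.
Context {k : fieldType}.
Implicit Types V A B : vectType k.

(* Coordinates in the library's standard basis [vbasis {:V}] of [V]. *)
Definition crd V (i : 'I_(\dim {:V})) (v : V) : k := coord (vbasis {:V}) i v.

Definition dualspace V : vectType k := 'Hom(V, k^o).

Definition tens A B : vectType k := 'M[k]_(\dim {:A}, \dim {:B}).

Definition tmul A B (a : A) (b : B) : tens A B :=
  \matrix_(i, j) (crd i a * crd j b).

Lemma crd_sum V (v : V) : v = \sum_i crd i v *: (vbasis {:V})`_i.
Proof. exact: coord_vbasis (memvf v). Qed.

Lemma tens_universal A B V (f : A -> B -> V) :
    (forall a, linear (f a)) -> (forall b, linear (f^~ b)) ->
  exists2 g : 'Hom(tens A B, V), (forall a b, g (tmul a b) = f a b)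
    & forall h : 'Hom(tens A B, V), (forall a b, h (tmul a b) = f a b) -> h = g.
Proof.
move=> linr linl.
pose F a : {linear B -> V} :=
  HB.pack (f a) (GRing.isLinear.Build _ _ _ _ (f a) (linr a)).
pose G b : {linear A -> V} :=
  HB.pack (f^~ b) (GRing.isLinear.Build _ _ _ _ (f^~ b) (linl b)).
pose bA i := (vbasis {:A})`_i; pose bB j := (vbasis {:B})`_j.
pose g0 (M : tens A B) : V := \sum_i \sum_j M i j *: f (bA i) (bB j).
have lin_g0 : linear g0.
  move=> c M N; rewrite /g0 scaler_sumr -big_split; apply: eq_bigr => i _ /=.
  rewrite scaler_sumr -big_split; apply: eq_bigr => j _ /=.
  by rewrite !mxE scalerDl scalerA.
pose g1 : {linear tens A B -> V} :=
  HB.pack g0 (GRing.isLinear.Build _ _ _ _ g0 lin_g0).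
have g1E a b : g1 (tmul a b) = f a b.
  rewrite /g1 /= /g0 [in RHS](crd_sum a) -[RHS]/(G b _) linear_sum.
  apply: eq_bigr => i _; rewrite linearZ /= [in RHS](crd_sum b).
  rewrite -[f _ _]/(F (bA i) _) linear_sum scaler_sumr; apply: eq_bigr => j _.
  by rewrite linearZ /= scalerA mxE.
exists (linfun g1) => [a b|h hE]; first by rewrite lfunE g1E.
apply/lfunP => M; rewrite lfunE /= /g0 [in LHS](matrix_sum_delta M) linear_sum.
apply: eq_bigr => i _; rewrite linear_sum; apply: eq_bigr => j _.
rewrite linearZ /= -hE; congr (_ *: h _); apply/matrixP => i' j'.
rewrite !mxE /crd /bA /bB !coord_free ?(basis_free (vbasisP _)) //.
by rewrite [i == i']eq_sym [j == j']eq_sym -natrM mulnb.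
Qed.

(* The quotient of [V] by [N], realized on a complement of [N]. *)
Definition quotspace V (N : {vspace V}) : vectType k := subvs_of (N^C)%VS.

Definition quotmap V (N : {vspace V}) (v : V) : quotspace N :=
  vsproj (N^C)%VS (daddv_pi (N^C)%VS N v).

Lemma quotmap_linear V (N : {vspace V}) : linear (quotmap N).
Proof. by move=> a u v; rewrite /quotmap !linearP. Qed.

Lemma quotmap_eq0 V (N : {vspace V}) v : (quotmap N v == 0) = (v \in N).
Proof.
have dx : (N^C :&: N = 0)%VS by rewrite capvC capv_compl.
have su w : w \in (N^C + N)%VS by rewrite addvC addv_complf memvf.
rewrite /quotmap; apply/eqP/idP => [h|vN].
  have := congr1 vsval h; rewrite vsprojK ?memv_pi // linear0 => h0.
  by rewrite -(daddv_pi_add dx (su v)) h0 add0r memv_pi.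
have /eqP := daddv_pi_add dx (su v).
rewrite [daddv_pi N _ v]daddv_pi_id ?capv_compl //.
by rewrite -[X in _ == X]add0r (inj_eq (addIr v)) => /eqP->; rewrite linear0.
Qed.

Lemma quotmap_surj V (N : {vspace V}) (x : quotspace N) :
  exists v, quotmap N v = x.
Proof.
exists (vsval x); rewrite /quotmap daddv_pi_id ?subvsP ?vsvalK //.
by rewrite capvC capv_compl.
Qed.

Definition tpow V (m : nat) : vectType k :=
  {ffun {ffun 'I_m -> 'I_(\dim {:V})} -> k^o}.

Definition tpure V m (v : 'I_m -> V) : tpow V m :=
  [ffun g : {ffun 'I_m -> 'I_(\dim {:V})} => \prod_i crd (g i) (v i)].

Definition alt_relations V m : {vspace tpow V m} :=
  linspan (fun t => exists v : 'I_m -> V,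
    (exists i j, i != j /\ v i = v j) /\ t = tpure v).

Definition extpow V m : vectType k := quotspace (alt_relations V m).

Definition wedge V m (v : 'I_m -> V) : extpow V m :=
  quotmap (alt_relations V m) (tpure v).

(* Symmetric powers: Sym(V) is the polynomial ring on a basis of [V]. The
   library makes [dhomog n k l] a [vectType] only for [n > 0], whence this
   copy of the type. *)
Definition sympow V (l : nat) : Type := dhomog (\dim {:V}) k l.

HB.instance Definition _ V l :=
  GRing.Lmodule.copy (sympow V l) (dhomog (\dim {:V}) k l).

Lemma sympow_vect_axiom V l :
  Vector.axiom #|{: {m : 'X_{1..(\dim {:V}) < l.+1} | mdeg m == l}}| (sympow V l).
Proof.
pose I : finType := {m : 'X_{1..(\dim {:V}) < l.+1} | mdeg m == l}.
pose mon (j : 'I_#|{: I}|) : 'X_{1..(\dim {:V})} := bmnm (val (enum_val j)).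
have mon_inj : injective mon.
  by move=> i j eq_ij; apply/enum_val_inj/val_inj/val_inj.
have mon_deg j : mdeg (mon j) = l by apply/eqP; exact: (valP (enum_val j)).
have mon_surj m : mdeg m = l -> exists j, m = mon j.
  move=> dm; have lt : (mdeg m < l.+1)%N by rewrite dm.
  have dm' : mdeg (BMultinom lt) == l by rewrite /= dm.
  by exists (enum_rank (exist _ (BMultinom lt) dm' : I)); rewrite /mon enum_rankK.
pose f (p : sympow V l) : 'rV[k]_#|{: I}| :=
  \row_j (mpoly_of_dhomog p)@_(mon j).
exists f => [c p q|]; first by apply/rowP => j; rewrite !mxE mcoeffD mcoeffZ.
pose g (r : 'rV[k]_#|{: I}|) : {mpoly k[\dim {:V}]} :=
  \sum_j r 0 j *: 'X_[mon j].
have hg r : g r \is l.-homog.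
  by rewrite rpred_sum // => j _; rewrite rpredZ // dhomogX; apply/eqP/mon_deg.
have gE r j : (g r)@_(mon j) = r 0 j.
  rewrite raddf_sum /= (bigD1 j) //= mcoeffZ mcoeffX eqxx mulr1 big1 ?addr0 //.
  by move=> i ne; rewrite mcoeffZ mcoeffX (inj_eq mon_inj) (negbTE ne) mulr0.
exists (fun r => DHomog (hg r)) => [p|r]; last first.
  by apply/rowP => j; rewrite mxE gE.
apply/val_inj/mpolyP => m /=; case: (mdeg m =P l) => [/mon_surj[j ->]|/eqP ne].
  by rewrite gE mxE.
rewrite (dhomog_nemf_coeff (hg _) ne).
by rewrite (dhomog_nemf_coeff (dhomog_is_dhomog p) ne).
Qed.

HB.instance Definition _ V l :=
  Lmodule_hasFinDim.Build k (sympow V l) (sympow_vect_axiom V l).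

Definition linform V (v : V) : {mpoly k[\dim {:V}]} := \sum_i crd i v *: 'X_i.

Lemma sprod_homog V l (w : 'I_l -> V) : \prod_i linform (w i) \is l.-homog.
Proof.
elim: l w => [|l IH] w; first by rewrite big_ord0 dhomog1.
rewrite big_ord_recl; apply: (@dhomogM _ _ _ 1 _ l) => //.
rewrite rpred_sum // => i _; rewrite rpredZ // dhomogX; apply/eqP/mdeg1.
Qed.

Definition sprod V l (w : 'I_l -> V) : sympow V l := DHomog (sprod_homog w).

End MultilinearAlgebra.

Section Representation.
Context {k : fieldType} {U W : vectType k} {S : finType}.
Variables (e : S -> U) (phi : 'Hom(U, W)).
Implicit Types I J A : {set S}.

Definition Usp I : {vspace U} := <<[seq e i | i in I]>>%VS.
Definition Vsp I : {vspace W} := <<[seq phi (e i) | i in I]>>%VS.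

Section RepMatroid.

Let findep I := free [seq phi (e i) | i in I].

Let findep_ground I : findep I -> I \subset [set: S].
Proof. by rewrite subsetT. Qed.

Let findep_set0 : findep set0.
Proof. by rewrite /findep /image_mem enum_set0 nil_free. Qed.

Let findep_sub I J : I \subset J -> findep J -> findep I.
Proof.
move=> sIJ; rewrite /findep /image_mem => fJ.
have pJ : perm_eq (enum J) (enum I ++ enum (J :\: I)).
  apply: uniq_perm; rewrite ?cat_uniq ?enum_uniq ?andbT /=.
  - by [].
  - by apply/hasPn => x; rewrite !mem_enum inE => /andP[].
  move=> x; rewrite mem_cat !mem_enum in_setD.
  by case: (boolP (x \in I)) => //= /(subsetP sIJ).
by move: fJ; rewrite (perm_free (perm_map _ pJ)) map_cat => /catl_free.
Qed.

Let findep_aug I J : findep I -> findep J -> (#|I| < #|J|)%N ->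
  exists2 x, x \in J :\: I & findep (x |: I).
Proof.
rewrite /findep /image_mem => fI fJ ltIJ; apply/exists_inP; rewrite -[X in is_true X]negbK.
rewrite negb_exists_in; apply/negP => /forall_inP H.
have : (<<[seq phi (e i) | i in J]>> <= <<[seq phi (e i) | i in I]>>)%VS.
  apply/span_subvP => _ /imageP[x xJ ->].
  case: (boolP (x \in I)) => xI; first by apply/memv_span/image_f.
  have xJI : x \in J :\: I by rewrite inE xI.
  have := H x xJI; apply: contraR => xsp.
  have px : perm_eq (enum (x |: I)) (x :: enum I).
    apply: uniq_perm; rewrite /= ?mem_enum ?xI ?enum_uniq // => y.
    by rewrite inE !mem_enum in_setU1.
  by rewrite (perm_free (perm_map _ px)) /= free_cons xsp.
move/dimvS; rewrite (eqP fI) (eqP fJ) !size_map -!cardE.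
by rewrite leqNgt ltIJ.
Qed.

Definition rep_matroid : matroid S :=
  Matroid findep_ground findep_set0 findep_sub findep_aug.

End RepMatroid.

Definition rk I : nat := \dim (Vsp I).

(* Truncated subtraction is harmless: #|I| - rk I >= 1 for dependent sets [I],
   in particular for T-flats. *)
Definition level I : nat := (#|I| - rk I - 1)%N.

Definition tchain A (J : nat -> {set S}) : Prop :=
  [/\ J (level A) = A,
      (forall i, (i <= level A)%N -> tflat rep_matroid (J i) /\ level (J i) = i)
    & (forall i, (i < level A)%N -> J i \proper J i.+1)].

Definition mult_space A : {vspace sympow (subvs_of (Vsp A)) (level A)} :=
  if tflat rep_matroid A then
    linspan (fun p => exists (J : nat -> {set S})
                             (w : 'I_(level A) -> subvs_of (Vsp A)),
      [/\ tchain A J,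
          (forall i : 'I_(level A),
             vsval (w i) \in (Vsp (J i.+1 :\: J i) :&: Vsp (J i))%VS)
        & p = sprod w])
  else 0%VS.

Definition T_space A : vectType k :=
  tens (tens (dualspace (subvs_of (mult_space A)))
             (extpow (subvs_of (Usp A)) #|A|))
       (extpow (dualspace (subvs_of (Vsp A))) (rk A)).

End Representation.

(* Main.v *)
Require Import Defs.
From HB Require Import structures.
From mathcomp Require Import all_boot all_order all_algebra all_fingroup.
From mathcomp.multinomials Require Import mpoly.
From mathcomp Require Import zify ring.

(** The two exterior powers in the T-space are top powers, hence lines,
    so the claim is that the multiplicity space [S_A] has the dimension
    [beta ((M|A)^* )]. Write [v_i = phi (e_i)] and call a set cyclic when each
    of its vectors lies in the span of the others; the T-flats are the non-empty
    cyclic sets, and the level of one is its nullity minus one.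

    Summing over all subsets instead of over flats ([beta_subsets]) and passing
    to complements turns the right-hand side into
    [crapo v A = (-1) ^ (r(A) + 1) * \sum_(Y <= A) (-1) ^ |Y| * nullity(Y)],
    a number that satisfies deletion-contraction,
    [crapo (v, A) = crapo (v, A \ a) + crapo (v / v_a, A \ a)], whenever
    [v_a != 0] and [A] is cyclic ([crapo_contract]).

    The same recursion for the multiplicity space comes from the exact sequence
    given by multiplication by [v_a] and reduction modulo [v_a] on a symmetric
    power ([dim_sym_split]). That [S_A] contains enough is seen on generators:
    [v_a] times a product for [A \ a] is a product for [A], and each product
    for the contraction lifts to one for [A] ([flagprod_lift]). That [S_A] is
    not too large is not visible on generators; it follows from a condition that
    cuts out a space with an obvious deletion-contraction bound. A polynomial
    [p] on the dual of [V_A] satisfies it when, for each functional [eta] that is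
    non-zero on exactly [m > 0] of the [v_i], [i] in [A], the polynomial
    [p (y + t eta)] has degree at most [m - 2] in [t], and so is zero if
    [m = 1]. The products along chains of T-flats satisfy this condition ([flagprod_lowdeg]); dividing by [v_a]
    lowers both the degree and [m] by one when [eta v_a != 0], and reducing
    modulo [v_a] restricts the condition to the [eta] that vanish on [v_a].

    So every subspace that contains the products and consists of polynomials of
    low degree has dimension [crapo v A], by induction on [A]
    ([dim_flag_space]), and [S_A] is such a subspace. *)

Set Implicit Arguments.
Unset Strict Implicit.
Unset Printing Implicit Defensive.
Import GRing.Theory.
Local Open Scope ring_scope.

(** * Alternating sums over subsets *)

Section Subsets.
Variable T : finType.
Implicit Types A X Y : {set T}.

Lemma sum_subset_split (R : nmodType) A a (f : {set T} -> R) : a \in A ->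
  \sum_(Y : {set T} | Y \subset A) f Y =
  \sum_(Y : {set T} | Y \subset A :\ a) (f Y + f (a |: Y)).
Proof.
move=> aA; rewrite big_split /= (bigID (fun Y : {set T} => a \in Y)) /= addrC.
congr (_ + _).
  by apply: eq_bigl => Y; rewrite subsetD1.
rewrite (reindex_onto (fun Y => a |: Y) (fun Y => Y :\ a)) /=; last first.
  by move=> Y /andP[_ aY]; rewrite setD1K.
apply: eq_bigl => Y; rewrite subsetD1 setU11 andbT subUset sub1set aA /=.
congr (_ && _); apply/eqP/idP => [<-|aY]; first by rewrite !inE eqxx.
by rewrite setU1K.
Qed.

Lemma sum_subset_sign A : A != set0 ->
  \sum_(Y : {set T} | Y \subset A) (-1) ^+ #|Y| = 0 :> int.
Proof.
case/set0Pn=> a aA; rewrite (sum_subset_split _ aA) big1 // => Y.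
rewrite subsetD1 => /andP[_ aY]; rewrite cardsU1 aY exprS mulN1r addrN.
by [].
Qed.

End Subsets.

(** * Beta as a sum over all subsets *)

Section MatroidRank.
Variable T : finType.
Variable M : matroid T.
Implicit Types X Y I J F : {set T}.

Lemma indep_rank I X : indep M I -> I \subset X -> (#|I| <= rank M X)%N.
Proof. by move=> iI sI; apply: leq_bigmax_cond; rewrite iI. Qed.

Lemma rank_basis X : exists I, [/\ indep M I, I \subset X & rank M X = #|I|].
Proof.
have [J [_ sJ iJ maxJ]] := basis_ext (indep_set0 M) (sub0set X).
exists J; split=> //; apply/eqP; rewrite eqn_leq.
apply/andP; split; last exact: indep_rank.
by apply/bigmax_leqP => K /andP[iK sK]; apply: maxJ.
Qed.

Lemma rankS X Y : X \subset Y -> (rank M X <= rank M Y)%N.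
Proof.
move=> sXY; have [I [iI sI ->]] := rank_basis X.
exact: indep_rank iI (subset_trans sI sXY).
Qed.

Lemma rank_basis_ext I X : indep M I -> I \subset X ->
  exists J, [/\ I \subset J, J \subset X, indep M J & rank M X = #|J|].
Proof.
move=> iI sI; have [J [sIJ sJ iJ maxJ]] := basis_ext iI sI.
exists J; split=> //; have [K [iK sK eK]] := rank_basis X.
by apply/eqP; rewrite eqn_leq (indep_rank iJ sJ) eK maxJ.
Qed.

Definition closure X : {set T} :=
  [set x in ground M | rank M (x |: X) == rank M X].

Lemma sub_closure X : X \subset ground M -> X \subset closure X.
Proof.
move=> sX; apply/subsetP => x xX; rewrite inE (subsetP sX) //=.
by rewrite (setUidPr _) // sub1set.
Qed.

Lemma closureP X x I : x \in closure X -> indep M I -> I \subset X ->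
  rank M X = #|I| -> indep M (x |: I) -> x \in I.
Proof.
rewrite inE => /andP[_ /eqP rx] iI sI rI ixI; apply: contraT => xI.
have := indep_rank ixI (setUS [set x] sI).
by rewrite rx rI cardsU1 xI ltnn.
Qed.

Lemma rank_closure X : X \subset ground M -> rank M (closure X) = rank M X.
Proof.
move=> sX; apply/eqP; rewrite eqn_leq [X in _ && X]rankS ?sub_closure // andbT leqNgt.
apply/negP => lt; have [I [iI sI rI]] := rank_basis X.
have [K [iK sK rK]] := rank_basis (closure X).
have [|x /setDP[xK xI] ixI] := indep_aug iI iK; first by rewrite -rI -rK.
by move: xI; rewrite (closureP (subsetP sK _ xK) iI sI rI ixI).
Qed.

(** A basis of [X] extends to a basis [J] of [F]; if some [x] of the closure lay
    outside [F], then flatness would make [J] extendable by [x], although [x]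
    depends on the basis of [X]. *)
Lemma closure_min X F : X \subset F -> flat M F -> closure X \subset F.
Proof.
move=> sX /andP[sF /forall_inP flatF]; apply/subsetP => x xcl.
apply: contraT => xF; have xg : x \in ground M by move: xcl; rewrite inE => /andP[].
have [I [iI sI rI]] := rank_basis X.
have [J [sIJ sJ iJ rJ]] := rank_basis_ext iI (subset_trans sI sX).
have [K [iK sK rK]] := rank_basis (x |: F).
have lt : (#|J| < #|K|)%N by rewrite -rJ -rK flatF // inE xF.
have [y /setDP[yK yJ] iyJ] := indep_aug iJ iK lt.
have yx : y = x.
  have := subsetP sK _ yK; rewrite !inE => /predU1P[//|yF].
  have := @indep_rank (y |: J) F iyJ.
  by rewrite subUset sub1set yF sJ rJ cardsU1 yJ ltnn => /(_ isT).
have ixI : indep M (x |: I) by apply: indep_sub (setUS _ sIJ) _; rewrite -yx.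
case/negP: xF; apply: (subsetP (subset_trans sI sX)).
exact: closureP xcl iI sI rI ixI.
Qed.

Lemma closure_flat X : X \subset ground M -> flat M (closure X).
Proof.
move=> sX; rewrite /flat; apply/andP; split.
  by apply/subsetP => x; rewrite inE => /andP[].
apply/forall_inP => x /setDP[xg xcl]; rewrite ltn_neqAle rankS ?subsetUr //.
rewrite andbT; apply: contra xcl => /eqP rx; rewrite inE xg /=.
rewrite eqn_leq [X in _ && X]rankS ?subsetUr // andbT -(rank_closure sX) rx.
by rewrite rankS // setUS // sub_closure.
Qed.

Hypothesis loopless : forall x, x \in ground M -> rank M [set x] = 1%N.

Lemma rank0 : rank M set0 = 0%N.
Proof.
have [I [_ sI ->]] := rank_basis set0.
by move: sI; rewrite subset0 => /eqP ->; rewrite cards0.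
Qed.

Lemma flat0 : flat M set0.
Proof.
rewrite /flat sub0set; apply/forall_inP => x; rewrite setD0 => xg.
by rewrite setU0 loopless // rank0.
Qed.

(** Both sides satisfy the recursion that defines the
    Moebius function, since the subsets of a flat are sorted by their
    closures and the signs of the subsets of a non-empty set cancel. *)
Lemma mobius_closure F : flat M F ->
  mobius (flats M) set0 F =
  \sum_(X : {set T} | (X \subset ground M) && (closure X == F)) (-1) ^+ #|X|.
Proof.
have [n] := ubnP #|F|; elim: n F => // n IH F ltn flatF.
have sF : F \subset ground M by case/andP: flatF.
have [F0|F0] := eqVneq F set0.
  rewrite F0 mobius_refl (big_pred1 set0) ?cards0 // => X /=.
  apply/andP/eqP => [[sX /eqP clX]|->].
    by apply/eqP; rewrite -subset0 -clX sub_closure.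
  split; first exact: sub0set.
  by rewrite -subset0 closure_min ?flat0.
have := @mobius_sum _ (flats M) set0 F.
rewrite inE flatF proper0 F0 => /(_ isT isT).
rewrite (bigD1 F) /=; last by rewrite inE flatF sub0set subxx.
move/(canRL (addrK _)); rewrite add0r => ->.
have := sum_subset_sign F0.
rewrite (partition_big closure (fun G => (G \in flats M) && (G \subset F))) /=;
  last first.
  move=> X sX; rewrite inE closure_flat ?(subset_trans sX) //=.
  exact: closure_min.
rewrite (bigD1 F) /=; last by rewrite inE flatF subxx.
move/(canRL (addrK _)); rewrite add0r => e1.
transitivity (\sum_(X : {set T} | (X \subset F) && (closure X == F)) (-1) ^+ #|X| : int);
  last first.
  apply: eq_bigl => X; apply/andP/andP => -[sX /eqP cX]; split; rewrite ?cX //.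
    exact: subset_trans sF.
  by rewrite -cX sub_closure.
rewrite e1; congr (- _); apply: eq_big => [G|G]; first by rewrite sub0set.
rewrite inE sub0set => /andP[/andP[flatG sGF] neG].
rewrite IH //; last first.
  by rewrite -ltnS (leq_trans _ ltn) // ltnS proper_card // properEneq neG.
apply: eq_bigl => X; apply/andP/andP => -[sX /eqP cX]; split; rewrite ?cX //.
  by apply: subset_trans sGF; rewrite -cX sub_closure.
exact: subset_trans sX sF.
Qed.

(** A set and its closure have the same rank, so the signs of the sets with a
    given closure can be collected into the Moebius function. *)
Lemma beta_subsets : beta M =
  (-1) ^+ rank M (ground M) *
  \sum_(X : {set T} | X \subset ground M) (-1) ^+ #|X| * (rank M X)%:Z.
Proof.
rewrite /beta; congr (_ * _).
have -> : \bigcap_(Y in flats M) Y = set0.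
  by apply/eqP; rewrite -subset0 bigcap_inf // inE flat0.
rewrite [RHS](partition_big closure (fun G => G \in flats M)) /=; last first.
  by move=> X sX; rewrite inE closure_flat.
apply: eq_bigr => F; rewrite inE => flatF; rewrite mobius_closure // mulr_suml.
apply: eq_bigr => X /andP[sX /eqP <-]; by rewrite rank_closure.
Qed.

End MatroidRank.

(** * Ranks in the dual matroid *)

Section DualRank.
Variable T : finType.
Variable M : matroid T.
Implicit Types X I : {set T}.

Lemma rank_restrict (A X : {set T}) : X \subset A ->
  rank (restrict M A) X = rank M X.
Proof.
move=> sXA; apply: eq_bigl => I /=; rewrite -andbA; congr (_ && _).
by apply: andb_idl => sI; apply: subset_trans sI sXA.
Qed.

Lemma card_basis B : Defs.basis M B -> #|B| = rank M (ground M).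
Proof.
case/basisP=> iB mB; have [K [iK sK rK]] := rank_basis M (ground M).
apply/eqP; rewrite eqn_leq; apply/andP; split; last by rewrite rK mB.
by rewrite indep_rank // indep_ground.
Qed.

(** An independent set of the dual inside [X] misses a basis [B], and its size is
    largest when [B] meets the complement of [X] in as many elements as
    possible. *)
Lemma rank_dual X : X \subset ground M ->
  (rank (dual M) X + rank M (ground M) = #|X| + rank M (ground M :\: X))%N.
Proof.
move=> sX; apply/eqP; rewrite eqn_leq; apply/andP; split.
  have [I [/andP[_ /existsP[B /andP[bB dIB]]] sIX ->]] := rank_basis (dual M) X.
  rewrite -(card_basis bB); have /basisP[iB _] := bB.
  have e1 := cardsID X B; have e2 := cardsID B X; rewrite setIC in e1.
  have le1 : (#|I| <= #|X :\: B|)%N.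
    by rewrite subset_leq_card // subsetD sIX.
  have le2 : (#|B :\: X| <= rank M (ground M :\: X))%N.
    apply: indep_rank; first exact: indep_sub (subsetDl _ _) iB.
    by rewrite setSD // indep_ground.
  lia.
have [J [iJ sJ rJ]] := rank_basis M (ground M :\: X).
have [B [sJB sB iB rB]] :=
  rank_basis_ext iJ (subset_trans sJ (subsetDl _ _)).
have bB : Defs.basis M B.
  by apply/basisP; split=> // K iK; rewrite -rB indep_rank // indep_ground.
have le1 : (#|X :\: B| <= rank (dual M) X)%N.
  apply: indep_rank (subsetDl _ _); apply/andP; split.
    exact: subset_trans (subsetDl _ _) sX.
  apply/existsP; exists B; rewrite bB /= -setI_eq0 setIDAC -setIDA setDv.
  by rewrite setI0.
have le2 : (#|J| <= #|B :\: X|)%N.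
  by rewrite subset_leq_card // subsetD sJB; move: sJ; rewrite subsetD => /andP[].
have e1 := cardsID X B; have e2 := cardsID B X; rewrite setIC in e1.
rewrite rB rJ; lia.
Qed.

End DualRank.

(** * Nullities of vector configurations *)

Section Configuration.
Context {k : fieldType} {W : vectType k} {S : finType}.
Implicit Types (v : S -> W) (I J Y A : {set S}).

Definition sp v I : {vspace W} := <<[seq v i | i in I]>>%VS.

Definition nul v I : nat := (#|I| - \dim (sp v I))%N.

Definition cyclic v A : bool := [forall x in A, v x \in sp v (A :\ x)].

Lemma mem_sp v I i : i \in I -> v i \in sp v I.
Proof. by move=> iI; apply/memv_span/image_f. Qed.

Lemma sp_subP v I (X : {vspace W}) :
  reflect (forall i, i \in I -> v i \in X) (sp v I <= X)%VS.
Proof.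
apply: (iffP idP) => [sX i iI|sX]; first exact: subvP sX _ (mem_sp v iI).
by apply/span_subvP => _ /imageP[i iI ->]; apply: sX.
Qed.

Lemma spS v I J : I \subset J -> (sp v I <= sp v J)%VS.
Proof. by move=> sIJ; apply/sp_subP => i /(subsetP sIJ)/mem_sp. Qed.

Lemma mem_spS v I J w : I \subset J -> w \in sp v I -> w \in sp v J.
Proof. by move/(spS v)/subvP; apply. Qed.

Lemma spU1 v a I : sp v (a |: I) = (<[v a]> + sp v I)%VS.
Proof.
apply/eqP; rewrite eqEsubv subv_add -memvE spS ?subsetUr // mem_sp ?setU11 //.
rewrite !andbT; apply/sp_subP => i; rewrite !inE => /predU1P[->|iI].
  by rewrite memvE addvSl.
by apply: subvP (addvSr _ _) _ _; apply: mem_sp.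
Qed.

Lemma spU1_id v a I : v a \in sp v I -> sp v (a |: I) = sp v I.
Proof. by rewrite spU1 memvE => /addv_idPr. Qed.

Lemma dim_spU1 v a I :
  \dim (sp v (a |: I)) = ((v a \notin sp v I) + \dim (sp v I))%N.
Proof.
have [vI|vI] := boolP (v a \in sp v I); first by rewrite spU1_id.
rewrite spU1 dimv_disjoint_sum ?dim_vline.
  by case: eqP vI => // ->; rewrite mem0v.
apply/eqP; rewrite -subv0; apply/subvP => w; rewrite memv_cap memv0.
case/andP=> /vlineP[c ->] cI; apply: contraR vI; rewrite scaler_eq0 negb_or.
by case/andP=> c0 _; have := memvZ c^-1 cI; rewrite scalerA mulVf ?scale1r.
Qed.

Lemma dim_sp v I : (\dim (sp v I) <= #|I|)%N.
Proof. by apply: leq_trans (dim_span _) _; rewrite size_map -cardE. Qed.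

Lemma nulE v I : (\dim (sp v I) + nul v I = #|I|)%N.
Proof. by rewrite /nul subnKC // dim_sp. Qed.

Lemma nulU1 v a I : a \notin I -> nul v (a |: I) = ((v a \in sp v I) + nul v I)%N.
Proof.
move=> aI; have := nulE v (a |: I); have := nulE v I.
rewrite cardsU1 aI dim_spU1; case: (_ \in sp v I) => /=; lia.
Qed.

Lemma nul_set0 v : nul v set0 = 0%N.
Proof. by rewrite /nul cards0. Qed.

Lemma nulS v I J : I \subset J -> (nul v I <= nul v J)%N.
Proof.
have [n] := ubnP #|J|; elim: n J => // n IH J ltn sIJ.
have [->//|] := eqVneq I J; rewrite eqEsubset sIJ /= => /subsetPn[a aJ aI].
have := nulU1 v (negbT (setD11 a J)); rewrite setD1K // => ->.
apply: leq_trans (IH (J :\ a) _ _) (leq_addl _ _); last by rewrite subsetD1 sIJ.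
by rewrite -ltnS (leq_trans _ ltn) // ltnS [X in (_ < X)%N](cardsD1 a) aJ.
Qed.

Lemma cyclicP v A :
  reflect (forall x, x \in A -> v x \in sp v (A :\ x)) (cyclic v A).
Proof. exact: forall_inP. Qed.

Lemma cyclic_nulD1 v A a : cyclic v A -> a \in A -> nul v A = (nul v (A :\ a)).+1.
Proof.
move=> /cyclicP cA aA; have := nulU1 v (negbT (setD11 a A)).
by rewrite setD1K // cA.
Qed.

Lemma cyclic_spD1 v A a : cyclic v A -> a \in A -> sp v (A :\ a) = sp v A.
Proof.
by move=> /cyclicP cA aA; rewrite -[in RHS](setD1K aA) spU1_id // cA.
Qed.

Lemma cyclic_nul_proper v A J : cyclic v A -> J \proper A -> (nul v J < nul v A)%N.
Proof.
move=> cA /properP[sJA [a aA aJ]]; rewrite (cyclic_nulD1 cA aA) ltnS.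
by rewrite nulS // subsetD1 sJA.
Qed.

Lemma nul_dependent v I : nul v I != 0%N ->
  exists2 y, y \in I & v y \in sp v (I :\ y).
Proof.
have [N] := ubnP #|I|; elim: N I => // N IH I ltN nI.
have /set0Pn[y yI] : I != set0 by apply: contraNneq nI => ->; rewrite nul_set0.
have [vy|vy] := boolP (v y \in sp v (I :\ y)); first by exists y.
have nI' := nulU1 v (negbT (setD11 y I)).
rewrite setD1K // (negbTE vy) add0n in nI'.
have [||z /setD1P[_ zI] vz] := IH (I :\ y); rewrite -?nI' //.
  by move: ltN; rewrite (cardsD1 y I) yI.
by exists z => //; apply: mem_spS vz; rewrite setDDl setUC -setDDl; apply: subsetDl.
Qed.

(** For a T-flat [A], this is the beta invariant of the dual of the matroid of the
    vectors [v i], [i] in [A]. Up to sign, the same sum over ranks differs only for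
    sets with one element; with nullities, the number also vanishes on a single
    coloop, as the recursion requires. *)
Definition crapo v A : int :=
  (-1) ^+ (\dim (sp v A)).+1 *
  \sum_(Y : {set S} | Y \subset A) (-1) ^+ #|Y| * (nul v Y)%:Z.

Lemma crapo_split v A a : a \in A ->
  crapo v A = (-1) ^+ (\dim (sp v A)).+1 *
    \sum_(Y : {set S} | Y \subset A :\ a)
       (-1) ^+ #|Y| * ((nul v Y)%:Z - (nul v (a |: Y))%:Z).
Proof.
move=> aA; rewrite /crapo (sum_subset_split _ aA); congr (_ * _).
apply: eq_bigr => Y; rewrite subsetD1 => /andP[_ aY].
by rewrite cardsU1 aY exprS mulN1r mulNr mulrBr.
Qed.

Lemma crapo_coloop v A a : a \in A -> v a \notin sp v (A :\ a) -> crapo v A = 0.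
Proof.
move=> aA va; rewrite (crapo_split v aA) big1 ?mulr0 // => Y sY.
have aY : a \notin Y by move: sY; rewrite subsetD1 => /andP[].
rewrite nulU1 // (negbTE (contra (mem_spS sY) va)) subrr mulr0 //.
Qed.

Lemma crapo_circuit v A : cyclic v A -> nul v A = 1%N -> crapo v A = 1.
Proof.
move=> cA nA; rewrite /crapo (bigD1 A) //= big1 => [|Y /andP[sY neY]]; last first.
  have := @cyclic_nul_proper v A Y cA; rewrite properEneq neY sY nA ltnS leqn0.
  by move=> /(_ isT)/eqP->; rewrite mulr0.
have := nulE v A; rewrite nA addn1 => ->.
by rewrite addr0 mulr1 -exprD addnn -mul2n exprM sqrrN !expr1n.
Qed.

(** Adding the loop [a] raises each nullity by one, which leaves the alternating
    sum of the constant 1. *)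
Lemma crapo_loop v A a b : a \in A -> v a = 0 -> b \in A -> b != a ->
  crapo v A = 0.
Proof.
move=> aA va bA ba; rewrite (crapo_split v aA) (eq_bigr (fun Y => - ((-1) ^+ #|Y|))).
  rewrite sumrN sum_subset_sign ?oppr0 ?mulr0 //; apply/set0Pn; exists b.
  by rewrite !inE ba.
move=> Y; rewrite subsetD1 => /andP[_ aY]; rewrite nulU1 // va mem0v.
by rewrite add1n intS opprD addrCA subrr addr0 mulrN1.
Qed.

(** The contraction of [a] is represented inside the same space [W], by an
    endomorphism with kernel the line of [v a]. This keeps all configurations of
    the induction in one space. *)
Section Contraction.
Variables (v : S -> W) (a : S) (pi : 'End(W)).
Hypothesis ker_pi : (lker pi = <[v a]>)%VS.
Hypothesis va0 : v a != 0.

Lemma sp_contract I : sp (pi \o v) I = (pi @: sp v I)%VS.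
Proof.
by rewrite /sp limg_span -map_comp.
Qed.

Lemma dim_contract I : (\dim (sp (pi \o v) I)).+1 = \dim (sp v (a |: I)).
Proof.
have -> : sp (pi \o v) I = sp (pi \o v) (a |: I).
  rewrite spU1_id //= (_ : pi (v a) = 0) ?mem0v //.
  by apply/eqP; rewrite -memv_ker ker_pi memv_line.
rewrite sp_contract -(limg_ker_dim pi (sp v (a |: I))) ker_pi.
have /capv_idPr-> : (<[v a]> <= sp v (a |: I))%VS.
  by rewrite -memvE mem_sp ?setU11.
by rewrite dim_vline va0.
Qed.

Lemma nul_contract I : a \notin I -> nul (pi \o v) I = nul v (a |: I).
Proof.
move=> aI; have := nulE v (a |: I); have := nulE (pi \o v) I.
rewrite -dim_contract cardsU1 aI; lia.
Qed.

Lemma mem_sp_contract I w : (pi w \in sp (pi \o v) I) = (w \in sp v (a |: I)).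
Proof.
rewrite sp_contract; apply/idP/idP => [/memv_imgP[u uI e]|wI].
  have : w - u \in lker pi by rewrite memv_ker linearB /= e subrr.
  rewrite ker_pi spU1 => wu; rewrite -(subrK u w); exact: memv_add.
have -> : (pi @: sp v I)%VS = (pi @: sp v (a |: I))%VS; last exact: memv_img.
rewrite spU1 limgD (_ : (pi @: <[v a]>)%VS = 0%VS) ?add0v //.
by apply/eqP; rewrite -lkerE ker_pi.
Qed.

(** The subsets of [A] without and with the element [a] contribute the nullities of
    the deletion and of the contraction. *)
Lemma crapo_contract A : a \in A -> cyclic v A ->
  crapo v A = crapo v (A :\ a) + crapo (pi \o v) (A :\ a).
Proof.
move=> aA cA; rewrite (crapo_split v aA) /crapo cyclic_spD1 //.
have := dim_contract (A :\ a); rewrite setD1K // => <-.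
set d := \dim _; rewrite exprS [(-1) ^+ d.+1]exprS !mulN1r opprK.
rewrite mulNr -mulrBr -sumrB; congr (_ * _); apply: eq_bigr => Y.
by rewrite subsetD1 => /andP[_ aY]; rewrite nul_contract // mulrBr.
Qed.

Lemma cyclic_contract A : a \in A -> cyclic v A -> cyclic (pi \o v) (A :\ a).
Proof.
move=> aA /cyclicP cA; apply/cyclicP => x /setD1P[xa xA] /=.
rewrite mem_sp_contract; have := cA x xA; apply: mem_spS.
by apply/subsetP => y; rewrite !inE; case: (y == a); case: (y == x); rewrite ?andbF.
Qed.

End Contraction.
End Configuration.

(** * Linear forms, substitutions and translations *)

Lemma mpoly_rmorph_eq (k : fieldType) n (R : comNzRingType)
    (f g : {rmorphism {mpoly k[n]} -> R}) :
  (forall c, f c%:MP = g c%:MP) -> (forall i, f 'X_i = g 'X_i) -> f =1 g.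
Proof.
move=> fgC fgX; apply: mpolyind => [|c m p _ _ IH]; first by rewrite !rmorph0.
rewrite !rmorphD /= IH -mul_mpolyC !rmorphM /= fgC mpolyXE_id; congr (_ * _ + _).
rewrite !rmorph_prod; apply: eq_bigr => i _; by rewrite !rmorphXn /= fgX.
Qed.

Section Polynomials.
Context {k : fieldType} {W : vectType k}.
Local Notation n := (\dim {:W}).
Local Notation R := {mpoly k[n]}.
Local Notation bas i := ((vbasis {:W})`_i).
Implicit Types (w : W) (f : 'End(W)) (eta : 'Hom(W, k^o)) (p q : R).

Lemma crd_bas (i j : 'I_n) : crd j (bas i) = (i == j)%:R.
Proof. by rewrite /crd coord_free ?(basis_free (vbasisP _)). Qed.

Lemma linform_is_linear : linear (@linform k W).
Proof.
move=> c u w; rewrite /linform scaler_sumr -big_split; apply: eq_bigr => i _ /=.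
by rewrite /crd linearP scalerDl scalerA.
Qed.
HB.instance Definition _ :=
  GRing.isLinear.Build k W R _ (@linform k W) linform_is_linear.

Lemma linform_bas (i : 'I_n) : linform (bas i) = 'X_i.
Proof.
rewrite /linform (bigD1 i) //= crd_bas eqxx scale1r big1 ?addr0 // => j ne.
by rewrite crd_bas eq_sym (negbTE ne) scale0r.
Qed.

Lemma linform_eq0 w : (linform w == 0) = (w == 0).
Proof.
apply/eqP/eqP => [e|->]; last exact: linear0.
rewrite (crd_sum w) big1 // => i _.
have := congr1 (mcoeff U_(i)) e; rewrite mcoeff0 /linform raddf_sum /=.
rewrite (bigD1 i) //= big1 => [|j ne].
  by rewrite mcoeffZ mcoeffX eqxx mulr1 addr0 => ->; rewrite scale0r.
rewrite mcoeffZ mcoeffX; case: eqP => [/mnmP/(_ j)|]; rewrite ?mulr0 //.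
by rewrite !mnm1E eqxx eq_sym (negbTE ne).
Qed.

Lemma linform_homog w : linform w \is 1.-homog.
Proof.
by rewrite rpred_sum // => i _; rewrite rpredZ // dhomogX; apply/eqP/mdeg1.
Qed.

(** The action of an endomorphism of [W] on the symmetric algebra of [W]. *)
Definition subst f : R -> R :=
  mmap (@mpolyC n k) (fun i => linform (f (bas i))).
HB.instance Definition _ f := GRing.RMorphism.copy (subst f)
  (mmap (@mpolyC n k) (fun i => linform (f (bas i)))).

Lemma substC f c : subst f c%:MP = c%:MP.
Proof. exact: mmapC. Qed.

Lemma substX f i : subst f 'X_i = linform (f (bas i)).
Proof. by rewrite /subst mmapX mmap1U. Qed.

Lemma substZ f c p : subst f (c *: p) = c *: subst f p.
Proof. by rewrite -!mul_mpolyC rmorphM /= substC. Qed.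

Lemma subst_linform f w : subst f (linform w) = linform (f w).
Proof.
rewrite [in RHS](crd_sum w) !linear_sum /= [in LHS]/linform rmorph_sum /=.
by apply: eq_bigr => i _; rewrite substZ substX !linearZ.
Qed.

Lemma subst_homog f l p : p \is l.-homog -> subst f p \is l.-homog.
Proof.
move/dhomogP=> hp; rewrite [p]mpolyE rmorph_sum /= big_seq rpred_sum // => m.
move/hp=> <-; rewrite substZ rpredZ // mpolyXE_id rmorph_prod /= mdegE.
elim/big_rec2: _ => [|i y d _ hy]; first exact: dhomog1.
rewrite rmorphXn /= substX; apply: dhomogM => //.
by rewrite -[X in X.-homog]mul1n; apply/dhomogMn/linform_homog.
Qed.

(** [shift eta p] is [p (y + t eta)] as a polynomial in [t]. *)
Definition shift eta : R -> {poly R} :=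
  mmap (polyC \o @mpolyC n k)
       (fun i => ('X_i)%:P + (eta (bas i))%:MP%:P * 'X).
HB.instance Definition _ eta := GRing.RMorphism.copy (shift eta)
  (mmap (polyC \o @mpolyC n k)
     (fun i => ('X_i)%:P + (eta (bas i))%:MP%:P * 'X)).

Lemma shiftC eta c : shift eta c%:MP = c%:MP%:P.
Proof. exact: mmapC. Qed.

Lemma shiftX eta i :
  shift eta 'X_i = ('X_i)%:P + (eta (bas i))%:MP%:P * 'X.
Proof. by rewrite /shift mmapX mmap1U. Qed.

Lemma shiftZ eta c p : shift eta (c *: p) = c%:MP *: shift eta p.
Proof. by rewrite -mul_mpolyC rmorphM /= shiftC mul_polyC. Qed.

Lemma shift_linform eta w :
  shift eta (linform w) = (linform w)%:P + (eta w)%:MP%:P * 'X.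
Proof.
have etaw : eta w = \sum_(i < n) crd i w * (eta (bas i) : k) :> k.
  by rewrite {1}(crd_sum w) linear_sum; apply: eq_bigr => i _; rewrite linearZ.
rewrite etaw /linform !rmorph_sum /= mulr_suml -big_split; apply: eq_bigr => i _.
rewrite shiftZ shiftX -mul_mpolyC !rmorphM /= -mul_polyC.
by rewrite mulrDr mulrA.
Qed.

Lemma shift_subst eta f p :
  shift eta (subst f p) = map_poly (subst f) (shift (eta \o f)%VF p).
Proof.
apply: (@mpoly_rmorph_eq _ _ _ (shift eta \o subst f)
          (map_poly (subst f) \o shift (eta \o f)%VF)) => [c|i] /=.
  by rewrite substC !shiftC map_polyC /= substC.
rewrite substX shift_linform shiftX rmorphD rmorphM /= !map_polyC /= map_polyX.
by rewrite substX substC comp_lfunE.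
Qed.

Lemma shift_horner0 eta p : (shift eta p).[0] = p.
Proof.
apply: (@mpoly_rmorph_eq _ _ _ (horner_eval 0 \o shift eta) idfun) => [c|i] /=.
  by rewrite shiftC /horner_eval hornerC.
by rewrite shiftX /horner_eval !hornerE.
Qed.

Lemma shift_eq0 eta p : (shift eta p == 0) = (p == 0).
Proof.
apply/eqP/eqP => [e|->]; last exact: rmorph0.
by rewrite -(shift_horner0 eta p) e horner0.
Qed.

(** Invariance under [p (x + t b_i) = p x] gives [p (x - x_i b_i) = p x], so that
    the variable [x_i] does not occur in [p]. Derivatives would not show this in
    positive characteristic. *)
Lemma shift_const p : (forall eta, (size (shift eta p) <= 1)%N) ->
  p \is 0.-homog.
Proof.
move=> cp; apply/dhomogP => m mp; apply/eqP; rewrite /= mdeg_eq0.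
apply/eqP/mnmP => i; rewrite mnm0E; apply/eqP; apply: contraLR mp => mi0.
rewrite mcoeff_msupp negbK.
pose f i := crd i : W -> k^o.
have fP : linear (f i) by move=> c u w; rewrite /f /crd linearP.
pose fL : {linear W -> k^o} := HB.pack (f i) (GRing.isLinear.Build _ _ _ _ (f i) fP).
pose eta : 'Hom(W, k^o) := linfun fL.
have etaE (j : 'I_n) : eta (bas j) = (j == i)%:R by rewrite lfunE /= /f crd_bas.
(* The substitution of 0 for the i-th variable. *)
pose kill : R -> R := mmap (@mpolyC n k) (fun j => if j == i then 0 else 'X_j).
have killE : kill p = p.
  transitivity ((shift eta p).[- 'X_i]).
    apply: (@mpoly_rmorph_eq _ _ _ (mmap (@mpolyC n k) (fun j => if j == i then 0 else 'X_j))
        (horner_eval (- 'X_i) \o shift eta)) => [c|j] /=.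
      by rewrite shiftC /horner_eval hornerC mmapC.
    rewrite mmapX mmap1U shiftX etaE /horner_eval !hornerE.
    by case: eqP => [->|_]; rewrite ?mul1r ?subrr // mul0r addr0.
  have /size1_polyC e := cp eta; rewrite e hornerC.
  by rewrite -[RHS](shift_horner0 eta) [in RHS]e hornerC.
rewrite -killE /kill /mmap raddf_sum /= big1 // => m' _.
rewrite mcoeffCM [mmap1 _ m'](_ : _ = (m' i == 0%N)%:R * 'X_[m']).
  have [m'i|m'i] := eqVneq (m' i) 0%N; last by rewrite mul0r mcoeff0 mulr0.
  rewrite mul1r mcoeffX; case: eqP => [em|]; last by rewrite mulr0.
  by rewrite -em m'i eqxx in mi0.
rewrite /mmap1 mpolyXE_id (bigD1 i) //= [in RHS](bigD1 i) //= eqxx expr0n mulrA.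
congr (_ * _); last by apply: eq_bigr => j /negbTE->.
by case: eqP => [->|_]; rewrite ?expr0 ?mulr1 ?mul0r.
Qed.

Section Division.
Variables (f : 'End(W)) (lam : W -> k) (a : W).
Hypothesis fE : forall w, f w = w - lam w *: a.

(** Both sides are multiplicative modulo [a], and [f] is the identity modulo [a]
    on linear forms. *)
Lemma subst_mod p : exists q, p = subst f p + linform a * q.
Proof.
have closedM p1 p2 : (exists q, p1 = subst f p1 + linform a * q) ->
    (exists q, p2 = subst f p2 + linform a * q) ->
    exists q, p1 * p2 = subst f (p1 * p2) + linform a * q.
  move=> [q1 e1] [q2 e2].
  exists (q1 * subst f p2 + subst f p1 * q2 + linform a * q1 * q2).
  rewrite rmorphM /= {1}e1 {1}e2; ring.
have closedC c : exists q, c%:MP = subst f c%:MP + linform a * q.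
  by exists 0; rewrite substC mulr0 addr0.
elim/mpolyind: p => [|c m p _ _ [q e]]; first by exists 0; rewrite rmorph0 mulr0 addr0.
suff [q' e'] : exists q, c *: 'X_[m] = subst f (c *: 'X_[m]) + linform a * q.
  by exists (q' + q); rewrite rmorphD /= {1}e' {1}e; ring.
rewrite -mul_mpolyC; apply: (closedM) => //; rewrite mpolyXE_id.
elim/big_ind: _ => [||i _]; [exact: (closedC 1)|exact: closedM|].
elim: (m i) => [|d IH]; first exact: (closedC 1).
rewrite exprS; apply: (closedM) => //; exists (lam (bas i))%:MP.
by rewrite substX fE linearB linearZ /= linform_bas mulrC mul_mpolyC subrK.
Qed.

End Division.

Lemma pihomog_linformM w q l :
  pihomog mdeg l.+1 (linform w * q) = linform w * pihomog mdeg l q.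
Proof.
elim/mpolyind: q => [|c m q _ _ IH]; first by rewrite mulr0 !linear0 mulr0.
rewrite mulrDr !linearD /= IH mulrDr; congr (_ + _).
rewrite -scalerAr !linearZ /= -scalerAr; congr (_ *: _).
have hm : linform w * 'X_[m] \is (mdeg m).+1.-homog.
  by apply: (@dhomogM _ _ _ 1 _ (mdeg m)); rewrite ?linform_homog // dhomogX.
rewrite pihomogX; have [<-|ne] := eqVneq (mdeg m) l; first by rewrite pihomog_dE.
by rewrite (pihomog_ne0 _ hm) ?mulr0.
Qed.

Definition mul_sym w l (p : sympow W l) : sympow W l.+1 :=
  DHomog (@dhomogM _ _ _ 1 (linform w) l (mpoly_of_dhomog p)
            (linform_homog w) (dhomog_is_dhomog p)).

Lemma mul_sym_is_linear w l : linear (@mul_sym w l).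
Proof.
by move=> c p q; apply/val_inj; rewrite /= mulrDr scalerAr.
Qed.
HB.instance Definition _ w l :=
  GRing.isLinear.Build _ _ _ _ (@mul_sym w l) (@mul_sym_is_linear w l).

Definition subst_sym f l (p : sympow W l) : sympow W l :=
  DHomog (subst_homog f (dhomog_is_dhomog p)).

Lemma subst_sym_is_linear f l : linear (@subst_sym f l).
Proof. by move=> c p q; apply/val_inj; rewrite /= rmorphD /= substZ. Qed.
HB.instance Definition _ f l :=
  GRing.isLinear.Build _ _ _ _ (@subst_sym f l) (@subst_sym_is_linear f l).

(** The endomorphism [f] is a projection along [a], so the kernel of the
    substitution consists of the multiples of [a], and multiplication by [a] is
    injective. *)
Lemma dim_sym_split f (lam : W -> k) (a : W) l (X : {vspace sympow W l.+1}) :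
    (forall w, f w = w - lam w *: a) -> f a = 0 -> a != 0 ->
  \dim X = (\dim (linfun (@mul_sym a l) @^-1: X)
            + \dim (linfun (@subst_sym f l.+1) @: X))%N.
Proof.
move=> fE fa a0; rewrite -(limg_ker_dim (linfun (@subst_sym f l.+1)) X).
congr (_ + _)%N.
have mulI : lker (linfun (@mul_sym a l)) == 0%VS.
  rewrite -subv0; apply/subvP => p; rewrite memv_ker lfunE memv0 /=.
  move/eqP/(congr1 (@mpoly_of_dhomog _ _ _))/eqP => /=.
  by rewrite mulf_eq0 linform_eq0 (negbTE a0) /= => /eqP e; apply/eqP/val_inj.
set Y := (_ @^-1: X)%VS.
have Y0 : (Y :&: lker (linfun (@mul_sym a l)))%VS = 0%VS.
  by rewrite (eqP mulI) capv0.
rewrite -(limg_dim_eq Y0) {Y0}/Y.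
congr (\dim _); apply/vspaceP => p; rewrite memv_cap memv_ker lfunE.
apply/andP/memv_imgP => [[pX]|[q]].
  move/eqP/(congr1 (@mpoly_of_dhomog _ _ _)) => /= e.
  have [q] := subst_mod fE (val p); rewrite e add0r => pq.
  have pE : p = mul_sym a (DHomog (pihomogP mdeg l q)).
    apply/val_inj => /=; rewrite -pihomog_linformM -pq pihomog_dE //.
    exact: dhomog_is_dhomog.
  by exists (DHomog (pihomogP mdeg l q)); rewrite -?memv_preim lfunE /= -?pE.
rewrite -memv_preim lfunE /= => qX ->; split=> //; apply/eqP/val_inj => /=.
by rewrite rmorphM /= subst_linform fa linear0 mul0r.
Qed.

End Polynomials.

(** * Functionals and projections *)

Section Functionals.
Context {k : fieldType} {W : vectType k}.

Lemma separating_functional (U : {vspace W}) w : w \notin U ->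
  exists2 eta : 'Hom(W, k^o), (forall u, u \in U -> eta u = 0) & eta w = 1.
Proof.
rewrite -quotmap_eq0 => qw.
have [i ci] : exists i, crd i (quotmap U w) != 0.
  apply/existsP; apply: contraR qw; rewrite negb_exists => /forallP c0.
  rewrite (crd_sum (quotmap U w)) big1 // => i _.
  by rewrite (eqP (negbNE (c0 i))) scale0r.
pose f (u : W) : k^o := (crd i (quotmap U w))^-1 * crd i (quotmap U u).
have fP : linear f.
  move=> c u u'; rewrite /f /crd quotmap_linear linearP mulrDr.
  by rewrite mulrCA.
pose fL : {linear W -> k^o} := HB.pack f (GRing.isLinear.Build _ _ _ _ f fP).
exists (linfun fL) => [u|]; rewrite lfunE /= /f; last by rewrite mulVf.
by rewrite -quotmap_eq0 => /eqP->; rewrite /crd linear0 mulr0.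
Qed.

Lemma line_projection (a : W) : a != 0 ->
  exists pi : 'End(W), exists2 lam : W -> k,
    forall w, pi w = w - lam w *: a & lker pi = <[a]>%VS.
Proof.
move=> a0; have [|lam _ la] := @separating_functional 0%VS a; first by rewrite memv0.
pose f (w : W) := w - (lam w : k) *: a.
have fP : linear f.
  by move=> c u w; rewrite /f linearP scalerDl -scalerA scalerBr opprD addrACA.
pose fL : {linear W -> W} := HB.pack f (GRing.isLinear.Build _ _ _ _ f fP).
exists (linfun fL), lam => [w|]; first by rewrite lfunE.
apply/vspaceP => w; rewrite memv_ker lfunE /= /f subr_eq0.
apply/eqP/vlineP => [e|[c ->]]; first by exists (lam w).
by rewrite linearZ /= la /GRing.scale /= mulr1.
Qed.

End Functionals.

(** * Products along chains of T-flats *)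

Section FlagProducts.
Context {k : fieldType} {W : vectType k} {S : finType}.
Local Notation n := (\dim {:W}).
Local Notation R := {mpoly k[n]}.
Implicit Types (v : S -> W) (A J Y : {set S}) (p : R) (eta : 'Hom(W, k^o)).

(** The second index is the level. The nullities make the inclusion of [J] in [A]
    proper. *)
Inductive flagprod v : {set S} -> nat -> R -> Prop :=
| FlagCircuit A : cyclic v A -> nul v A = 1%N -> flagprod v A 0 1
| FlagStep A J l p w : flagprod v J l p -> J \subset A -> cyclic v A ->
    nul v A = l.+2 -> w \in sp v (A :\: J) -> w \in sp v J ->
    flagprod v A l.+1 (p * linform w).

Lemma flagprodP v A l p : flagprod v A l p ->
  [/\ cyclic v A, nul v A = l.+1 & p \is l.-homog].
Proof.
elim=> {A l p} [A cA nA|A J l p w _ [_ _ hp] _ cA nA _ _].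
  by split=> //; exact: dhomog1.
by split=> //; rewrite -addn1; apply: dhomogM => //; apply: linform_homog.
Qed.

Definition weight v A eta : nat := #|[set i in A | eta (v i) != 0]|.

(** This bounds the size, that is the degree plus one, of [p (y + t eta)] when
    [eta] has weight [m]. The value 1 for [m = 0] makes [p] invariant in the
    direction of each functional that vanishes on [V_A], as are the elements of
    the symmetric algebra of [V_A]; the value 0 for [m = 1] makes [p] vanish. *)
Definition shift_bound (m : nat) : nat := if m is m'.+1 then m' else 1.

Definition lowdeg v A p : Prop :=
  forall eta, (size (shift eta p) <= shift_bound (weight v A eta))%N.

(** Each vector of a cyclic set lies in the span of the others, so no functional
    is non-zero on it alone. *)
Lemma weight_cyclic v A eta : cyclic v A -> weight v A eta != 1%N.
Proof.
move=> /cyclicP cA; apply/negP => /cards1P[x ex].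
have : x \in [set i in A | eta (v i) != 0] by rewrite ex set11.
rewrite inE => /andP[xA]; apply/negP; rewrite negbK -memv_ker.
apply: subvP (cA x xA); apply/sp_subP => i /setD1P[ix iA].
rewrite memv_ker; apply: contraR ix => ei.
by have : i \in [set i in A | eta (v i) != 0]; [rewrite inE iA | rewrite ex inE].
Qed.

Lemma weight_gt0 v A eta w : w \in sp v A -> eta w != 0 -> (0 < weight v A eta)%N.
Proof.
move=> wA; rewrite lt0n; apply: contra => /eqP/cards0_eq e0.
rewrite -memv_ker; apply: subvP wA; apply/sp_subP => i iA; rewrite memv_ker.
by apply: contraFT (in_set0 i) => ei; rewrite -e0 inE iA.
Qed.

Lemma weight_split v A J eta : J \subset A ->
  weight v A eta = (weight v J eta + weight v (A :\: J) eta)%N.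
Proof.
move=> sJ; rewrite /weight -(cardsID J); congr (_ + _)%N;
  apply: eq_card => i; rewrite !inE.
  by case: (boolP (i \in J)) => [/(subsetP sJ)->|]; rewrite ?andbF ?andbT.
by rewrite andbA.
Qed.

(** A factor [w] of the product along a chain contributes to the degree in the
    direction [eta] only if [eta] does not vanish on the step of the chain
    that gives [w]; and then [eta] does not vanish on the T-flat before that
    step, which therefore contains at least two elements on which it is
    non-zero. *)
Lemma flagprod_lowdeg v A l p : flagprod v A l p -> lowdeg v A p.
Proof.
elim=> {A l p} [A cA nA|A J l p w fp IH sJ cA nA wAJ wJ] eta.
  rewrite rmorph1 size_poly1; have := weight_cyclic eta cA.
  by case: weight => [|[]].
have [-> | p0] := eqVneq p 0; first by rewrite mul0r rmorph0 size_poly0.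
rewrite rmorphM /= shift_linform; have := IH eta.
have [cJ _ _] := flagprodP fp.
have := weight_cyclic eta cA; have := weight_cyclic eta cJ.
rewrite (weight_split v eta sJ).
have [->|ew] := eqVneq (eta w) 0.
  rewrite mpolyC0 polyC0 mul0r addr0 mulrC mul_polyC => w1 w2 le.
  apply: leq_trans (size_scale_leq _ _) _; apply: leq_trans le _.
  move: (weight v J eta) (weight v (A :\: J) eta) w1 w2.
  by move=> [|[|m]] [|[|m']]; rewrite ?addn0 ?add0n ?addSn /=; lia.
have := weight_gt0 wAJ ew; have := weight_gt0 wJ ew.
move: (weight v J eta) (weight v (A :\: J) eta).
move=> [|[|m]] [|m'] // _ _ _ _; rewrite addSn addnS /= => le.
apply: leq_trans (size_polyMleq _ _) _.
have sz : (size ((linform w)%:P + (eta w)%:MP%:P * 'X)%R <= 2)%N.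
  by rewrite addrC size_MXaddC; case: ifP => // _; rewrite ltnS size_polyC_leq1.
rewrite -subn1 leq_subLR; apply: leq_trans (leq_add le sz) _; lia.
Qed.

(** * Deletion and contraction *)

Section Split.
Variables (v : S -> W) (a : S) (pi : 'End(W)) (A : {set S}).
Hypothesis ker_pi : (lker pi = <[v a]>)%VS.
Hypothesis va0 : v a != 0.
Hypothesis aA : a \in A.

Lemma weightD1 eta :
  weight v A eta = ((eta (v a) != 0)%R + weight v (A :\ a) eta)%N.
Proof.
rewrite /weight (cardsD1 a) inE aA; congr (_ + _)%N.
by apply: eq_card => i; rewrite !inE andbA.
Qed.

Lemma pi_va : pi (v a) = 0.
Proof. by apply/eqP; rewrite -memv_ker ker_pi memv_line. Qed.

Lemma lowdeg_contract p : lowdeg v A p -> lowdeg (pi \o v) (A :\ a) (subst pi p).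
Proof.
move=> lp eta; rewrite shift_subst; apply: leq_trans (size_poly _ _) _.
have -> : weight (pi \o v) (A :\ a) eta = weight v A (eta \o pi)%VF; last exact: lp.
rewrite weightD1 comp_lfunE pi_va linear0 eqxx add0n /weight.
by apply: eq_card => i; rewrite !inE comp_lfunE.
Qed.

Lemma lowdeg_delete q : lowdeg v A (linform (v a) * q) -> lowdeg v (A :\ a) q.
Proof.
move=> lq eta; have := lq eta; rewrite weightD1 rmorphM /= shift_linform.
have [->|q0] := eqVneq q 0; first by rewrite rmorph0 size_poly0.
have [->|ea] := eqVneq (eta (v a)) 0.
  by rewrite mpolyC0 polyC0 mul0r addr0 mul_polyC size_scale ?linform_eq0.
have sz : size ((linform (v a))%:P + (eta (v a))%:MP%:P * 'X) = 2%N.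
  rewrite addrC size_MXaddC polyC_eq0 mpolyC_eq0 (negbTE ea) /=.
  by rewrite size_polyC mpolyC_eq0 ea.
rewrite size_mul ?sz; [|by rewrite -size_poly_gt0 sz|by rewrite shift_eq0].
by rewrite add2n add1n /=; case: (weight _ _ _).
Qed.

(** If [a] is a coloop of [A], then some functional is non-zero on [v a] and on no
    other vector; in its direction the bound is 0. *)
Lemma lowdeg_coloop p : v a \notin sp v (A :\ a) -> lowdeg v A p -> p = 0.
Proof.
move=> /separating_functional[eta eta0 eta1] /(_ eta).
rewrite weightD1 eta1 oner_eq0 /weight.
rewrite (_ : [set _ in _ | _] = set0) ?cards0 /=.
  by rewrite leqn0 size_poly_eq0 shift_eq0 => /eqP.
apply/setP => i; rewrite !inE; apply/negbTE; rewrite negb_and negbK.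
have [iA|//] := boolP (_ && _); rewrite eta0 ?eqxx ?orbT //.
by apply: mem_sp; rewrite !inE.
Qed.

(** Every cyclic set of the contraction lifts to a cyclic set with the same
    nullity. In the dual matroid, where cyclic sets are complements of flats,
    this is the passage from a flat of the deletion to its closure. *)
Definition lift_cyclic (Y : {set S}) : {set S} :=
  if v a \in sp v Y then a |: Y else Y.

Lemma nul_lift Y : a \notin Y -> nul v (lift_cyclic Y) = nul (pi \o v) Y.
Proof.
move=> aY; rewrite (nul_contract ker_pi) // /lift_cyclic; case: ifP => // vaY.
by rewrite nulU1 // vaY.
Qed.

Lemma cyclic_lift Y : a \notin Y -> cyclic (pi \o v) Y -> cyclic v (lift_cyclic Y).
Proof.
move=> aY /cyclicP cY; rewrite /lift_cyclic; case: ifP => vaY; apply/cyclicP => x.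
  case/setU1P => [->|xY]; first by rewrite setU1K.
  have := cY x xY; rewrite /= (mem_sp_contract ker_pi); apply: mem_spS.
  apply/subsetP => y; rewrite !inE; case: eqP => [->|_] //=.
  by rewrite andbT => _; apply: contraNneq aY => ->.
move=> xY; have := cY x xY; rewrite /= (mem_sp_contract ker_pi).
rewrite spU1 => /memv_addP[_ /vlineP[c ->] [u uY e]].
have [c0|c0] := eqVneq c 0; first by rewrite e c0 scale0r add0r.
case/negP: vaY; have -> : v a = c^-1 *: (v x - u).
  by rewrite e addrK scalerA mulVf ?scale1r.
apply/memvZ/memvB; first exact: mem_sp.
exact: mem_spS (subsetDl _ _) uY.
Qed.

(** Every product along a chain of the contraction lifts. The three cases of
    a step from [J] to [Y] are those where [v a] lies in the span of [J], in the
    span of [Y] only, or in neither. *)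
Lemma flagprod_lift Y l p' : flagprod (pi \o v) Y l p' -> a \notin Y ->
  exists2 p, flagprod v (lift_cyclic Y) l p & subst pi p = p'.
Proof.
elim=> {Y l p'} [Y cY nY|Y J l p' w' _ IH sJ cY nY wYJ wJ] aY.
  exists 1; last exact: rmorph1.
  by apply: FlagCircuit; [exact: cyclic_lift | rewrite nul_lift].
have aJ : a \notin J by apply: contra aY; apply: (subsetP sJ).
have [p fp pE] := IH aJ.
suff [w [wE w1 w2]] : exists w, [/\ pi w = w',
    w \in sp v (lift_cyclic Y :\: lift_cyclic J) & w \in sp v (lift_cyclic J)].
  exists (p * linform w); last by rewrite rmorphM /= pE subst_linform wE.
  apply: FlagStep fp _ _ _ w1 w2; rewrite ?nul_lift ?cyclic_lift //.
  rewrite /lift_cyclic; case: ifP => [/(mem_spS sJ)->|_]; first exact: setUS.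
  by case: ifP => // _; apply: subset_trans sJ (subsetUr _ _).
have [u uYJ eu] : exists2 u, u \in sp v (Y :\: J) & w' = pi u.
  by move: wYJ; rewrite sp_contract => /memv_imgP.
have [t tJ et] : exists2 t, t \in sp v J & w' = pi t.
  by move: wJ; rewrite sp_contract => /memv_imgP.
have : u - t \in lker pi by rewrite memv_ker linearB /= -eu -et subrr.
rewrite ker_pi => /vlineP[c ec].
have uE : u = t + c *: v a by rewrite -ec addrC subrK.
have uY : u \in sp v Y by apply: mem_spS uYJ; apply: subsetDl.
have tY : t \in sp v Y by apply: mem_spS tJ.
rewrite /lift_cyclic; have [vJ|vJ] := boolP (v a \in sp v J).
  rewrite (mem_spS sJ vJ); exists u; split=> //.
    apply: mem_spS uYJ; apply/subsetP => y; rewrite !inE => /andP[yJ yY].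
    by rewrite yY orbT negb_or yJ !andbT; apply: contraNneq aY => <-.
  by rewrite spU1_id // uE; apply/memvD/memvZ.
have [vY|vY] := boolP (v a \in sp v Y).
  exists t; split=> //.
  have -> : t = u - c *: v a by rewrite uE addrK.
  apply: memvB; last by apply/memvZ/mem_sp; rewrite !inE eqxx aJ.
  by apply: mem_spS uYJ; apply: setSD; apply: subsetUr.
suff c0 : c = 0 by exists u; split=> //; rewrite uE c0 scale0r addr0.
apply: contraNeq vY => c0; have -> : v a = c^-1 *: (u - t).
  by rewrite ec scalerA mulVf ?scale1r.
by apply/memvZ/memvB.
Qed.

End Split.

Lemma dim_sympow0 (X : {vspace sympow W 0}) (u : sympow W 0) :
  val u = 1 -> u \in X -> \dim X = 1%N.
Proof.
move=> u1 uX; have u0 : u != 0.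
  by apply/eqP => e; have /eqP := u1; rewrite e eq_sym oner_eq0.
apply/eqP; rewrite eqn_leq; apply/andP; split; last first.
  rewrite lt0n dimv_eq0; apply: contraNneq u0 => X0.
  by rewrite X0 memv0 in uX.
have /dimvS : (X <= <[u]>)%VS.
  apply/subvP => p _; apply/vlineP; exists ((val p)@_0%MM); apply/val_inj.
  rewrite [RHS](_ : _ = (val p)@_0%MM *: val u) // u1.
  apply/mpolyP => m; rewrite mcoeffZ mcoeff1.
  have [->|m0] := eqVneq m 0%MM; first by rewrite mulr1.
  rewrite mulr0 (dhomog_nemf_coeff (dhomog_is_dhomog p)) //=.
  by rewrite mdeg_eq0.
by move/leq_trans; apply; rewrite dim_vline u0.
Qed.

(** Deletion and contraction for subspaces of the symmetric power that contain
    all products along chains and that satisfy the degree conditions: both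
    properties are inherited by the part divisible by a non-zero vector [v a],
    which belongs to the deletion of [a], and by the image modulo [v a], which
    belongs to the contraction. *)
Lemma dim_flag_space v A l (X : {vspace sympow W l}) :
    cyclic v A -> nul v A = l.+1 ->
    (forall p : sympow W l, flagprod v A l (val p) -> p \in X) ->
    (forall p : sympow W l, p \in X -> lowdeg v A (val p)) ->
  (\dim X)%:Z = crapo v A.
Proof.
have [N] := ubnP #|A|; elim: N v A l X => // N IH v A [|l] X ltN cA nA inX degX.
  have fp : flagprod v A 0 1 by apply: FlagCircuit.
  by rewrite crapo_circuit // (@dim_sympow0 X (DHomog (dhomog1 _ mdeg))) // inX.
have /set0Pn[b bA] : A != set0 by apply: contra_eqN nA => /eqP->; rewrite nul_set0.
(* If all vectors of [A] are zero, then [X] consists of constants of positive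
   degree. *)
have [/exists_inP[a aA va0]|] := boolP [exists a in A, v a != 0]; last first.
  rewrite negb_exists_in => /forall_inP/= v0.
  have {}v0 i : i \in A -> v i = 0 by move/v0; rewrite negbK => /eqP.
  have /set0Pn[c /setD1P[cb cA']] : A :\ b != set0.
    by apply: contra_eqN nA => /eqP e; rewrite (cyclic_nulD1 cA bA) e nul_set0.
  rewrite (crapo_loop bA (v0 b bA) cA' cb).
  suff -> : X = 0%VS by rewrite dimv0.
  apply/eqP; rewrite -subv0; apply/subvP => p pX; rewrite memv0.
  have hp : val p \is 0.-homog.
    apply: shift_const => eta; apply: leq_trans (degX p pX eta) _.
    rewrite /weight (_ : [set _ in _ | _] = set0) ?cards0 //.
    by apply/setP => i; rewrite !inE; case: (boolP (i \in A)) => //= /v0->; rewrite linear0 eqxx.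
  apply/eqP/val_inj/eqP => /=; apply: contraTT (dhomog_is_dhomog p) => p0.
  by apply/negP => /(dhomog_uniq p0 hp).
have [pi [lam piE ker_pi]] := line_projection va0.
have pa : pi (v a) = 0 by exact: pi_va.
rewrite (dim_sym_split X piE pa va0) PoszD (crapo_contract ker_pi va0 aA cA).
have ltD : (#|A :\ a| < N)%N by move: ltN; rewrite (cardsD1 a) aA.
congr (_ + _); last first.
  apply: IH => //; first exact: cyclic_contract.
  - by rewrite (nul_contract ker_pi) ?setD11 // setD1K.
  - move=> p' /(flagprod_lift ker_pi va0)/(_ (negbT (setD11 _ _)))[p].
    rewrite /lift_cyclic (cyclicP _ _ cA) // setD1K // => fp pE.
    have [_ _ hp] := flagprodP fp.
    have -> : p' = linfun (@subst_sym _ _ pi l.+1) (DHomog hp : sympow W l.+1).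
      by apply/val_inj; rewrite lfunE /= pE.
    by apply/memv_img/inX.
  - move=> _ /memv_imgP[p pX ->]; rewrite lfunE /=.
    exact: (lowdeg_contract ker_pi aA) (degX p pX).
have degD q : q \in (linfun (@mul_sym _ _ (v a) l) @^-1: X)%VS ->
    lowdeg v (A :\ a) (val q).
  rewrite -memv_preim lfunE /= => /degX; exact: lowdeg_delete.
(* If the deletion is not cyclic, then both its polynomials of low degree and its
   Crapo number vanish. *)
have [cD|] := boolP (cyclic v (A :\ a)).
  apply: IH => // [|p fp]; first by move: nA; rewrite (cyclic_nulD1 cA aA) => -[].
  rewrite -memv_preim lfunE inX //= mulrC.
  apply: (FlagStep fp) => //; first exact: subsetDl.
    rewrite setDDr setDv set0U; apply: mem_sp; by rewrite inE aA inE eqxx.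
  exact: (cyclicP _ _ cA).
rewrite negb_forall_in => /exists_inP[c cD vc].
rewrite (crapo_coloop cD vc); apply/eqP; rewrite -[0]/(0%:Z) eqz_nat dimv_eq0 -subv0.
apply/subvP => q /degD lq; rewrite memv0; apply/eqP/val_inj => /=.
exact: (lowdeg_coloop cD vc lq).
Qed.

End FlagProducts.

(** * Top exterior powers *)

Lemma dim_subvs (k : fieldType) (V : vectType k) (U : {vspace V}) :
  \dim {: subvs_of U} = \dim U.
Proof. by rewrite dimvf. Qed.

Lemma linspan_sub (k : fieldType) (V : vectType k) (P : V -> Prop)
    (X : {vspace V}) :
  (forall x, P x -> x \in X) -> (linspan P <= X)%VS.
Proof.
move=> PX; apply/subvP => x /linspanP[s [sP xs]].
by apply: subvP xs; apply/span_subvP => y /sP/PX.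
Qed.

Lemma mem_linspan (k : fieldType) (V : vectType k) (P : V -> Prop) x :
  P x -> x \in linspan P.
Proof.
move=> Px; apply/linspanP; exists [:: x]; rewrite memv_span ?mem_head //.
by split=> // y; rewrite inE => /eqP->.
Qed.

Section TopExteriorPower.
Context {k : fieldType} {V : vectType k}.
Local Notation bas i := ((vbasis {:V})`_i).

Section Alternation.
Variable m : nat.
Implicit Types (v : 'I_m -> V).

Lemma wedge_eq v v' : v =1 v' -> wedge v = wedge v'.
Proof.
move=> e; congr quotmap; apply/ffunP => g; rewrite !ffunE.
by apply: eq_bigr => i _; rewrite e.
Qed.

Lemma wedge_alt v i j : i != j -> v i = v j -> wedge v = 0.
Proof.
move=> ij vij; apply/eqP; rewrite quotmap_eq0; apply: mem_linspan.
by exists v; split=> //; exists i, j.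
Qed.

Lemma wedge_tperm v i j : i != j -> wedge (v \o tperm i j) = - wedge v.
Proof.
move=> ij.
(* [B] is additive in both arguments and alternating. *)
pose B x y := wedge (fun l => if l == i then x else if l == j then y else v l).
have Bxx x : B x x = 0.
  by apply: (wedge_alt ij); rewrite eqxx eq_sym (negbTE ij) eqxx.
have tpureE g x y :
  tpure (fun l => if l == i then x else if l == j then y else v l) g
    = crd (g i) x * (crd (g j) y
        * \prod_(l | (l != i) && (l != j)) crd (g l) (v l)).
  have ji : j != i by rewrite eq_sym.
  rewrite ffunE (bigD1 i) //= eqxx (bigD1 j) //= (negbTE ji) eqxx; congr (_ * (_ * _)).
  by apply: eq_bigr => l /andP[/negbTE-> /negbTE->].
have quotD (N : {vspace tpow V m}) t t' : quotmap N (t + t') = quotmap N t + quotmap N t'.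
  by have := quotmap_linear N 1 t t'; rewrite !scale1r.
have BDl x x' y : B (x + x') y = B x y + B x' y.
  rewrite /B /wedge -quotD; congr quotmap; apply/ffunP => g.
  by rewrite [RHS]ffunE !tpureE /crd linearD mulrDl.
have BDr x y y' : B x (y + y') = B x y + B x y'.
  rewrite /B /wedge -quotD; congr quotmap; apply/ffunP => g.
  by rewrite [RHS]ffunE !tpureE /crd linearD mulrDl mulrDr.
have := Bxx (v i + v j); rewrite BDl !BDr !Bxx add0r addr0 => /eqP.
rewrite addrC addr_eq0 => /eqP e.
transitivity (B (v j) (v i)); last (rewrite e; congr (- _));
  apply: wedge_eq => l /=.
  case: tpermP => [->|->|/eqP/negbTE-> /eqP/negbTE->] //; rewrite ?eqxx //.
  by rewrite eq_sym (negbTE ij).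
by case: eqP => [->|_] //; case: eqP => [->|].
Qed.

Lemma wedge_perm v (s : 'S_m) : wedge (v \o s) \in <[wedge v]>%VS.
Proof.
have [ts -> dts] := prod_tpermP s; elim: ts v dts => [|t ts IH] v /=.
  by move=> _; rewrite (wedge_eq (v' := v)) ?memv_line // => i; rewrite big_nil /= perm1.
case/andP=> dt dts; rewrite big_cons.
rewrite (wedge_eq (v' := (v \o (\prod_(t <- ts) tperm t.1 t.2)%g) \o tperm t.1 t.2));
  last by move=> i /=; rewrite permM.
by rewrite wedge_tperm // memvN IH.
Qed.

End Alternation.

(** The determinant is a non-zero functional that vanishes on the alternating
    relations, and the permutations of a basis give proportional wedges. *)
Lemma dim_extpow_top m : m = \dim {:V} -> \dim {: extpow V m} = 1%N.
Proof.
move=> ->; pose b (i : 'I_(\dim {:V})) : V := bas i.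
have crdb i j : crd j (b i) = (i == j)%:R.
  by rewrite /crd coord_free ?(basis_free (vbasisP _)).
pose D (t : tpow V (\dim {:V})) : k^o :=
  \sum_(s : 'S_(\dim {:V})) (-1) ^+ s * t [ffun i => s i].
have Dlin : linear D.
  move=> c t t'; rewrite /D scaler_sumr -big_split; apply: eq_bigr => s _ /=.
  by rewrite !ffunE mulrDr; congr (_ + _); apply: mulrCA.
pose DL : {linear tpow V (\dim {:V}) -> k^o} :=
  HB.pack D (GRing.isLinear.Build _ _ _ _ D Dlin).
have Dpure v : D (tpure v) = \det (\matrix_(i, j) crd j (v i)).
  apply: eq_bigr => s _; congr (_ * _); rewrite ffunE.
  by apply: eq_bigr => i _; rewrite mxE ffunE.
have Dalt : (alt_relations V (\dim {:V}) <= lker (linfun DL))%VS.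
  apply: linspan_sub => _ [v [[i [j [ij vij]]] ->]].
  rewrite memv_ker lfunE /= Dpure; apply/eqP/(determinant_alternate ij) => l.
  by rewrite !mxE vij.
have nz : wedge b != 0.
  rewrite quotmap_eq0; apply/negP => /(subvP Dalt).
  rewrite memv_ker lfunE /= Dpure (_ : \matrix_(i, j) _ = 1%:M) ?det1 ?oner_eq0 //.
  by apply/matrixP => i j; rewrite !mxE crdb.
suff -> : fullv = <[wedge b]>%VS by rewrite dim_vline nz.
apply/eqP; rewrite eqEsubv subvf andbT; apply/subvP => x _.
have [t <-] := quotmap_surj x.
pose N := alt_relations V (\dim {:V}).
pose QL : {linear tpow V (\dim {:V}) -> quotspace N} :=
  HB.pack (quotmap N) (GRing.isLinear.Build _ _ _ _ _ (quotmap_linear N)).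
have -> : t = \sum_g t g *: tpure (fun i => b (g i)).
  apply/ffunP => h; rewrite sum_ffunE (bigD1 h) //= big1 => [|g gh].
    rewrite addr0 !ffunE big1 ?[_ *: _]mulr1 // => i _.
    by rewrite crdb eqxx.
  rewrite !ffunE; have [i ghi] : exists i, g i != h i.
    by apply/existsP; apply: contraR gh; rewrite negb_exists => /forallP e;
       apply/eqP/ffunP => i; apply/eqP/negbNE.
  by rewrite (bigD1 i) //= crdb (negbTE ghi) mul0r [_ *: _]mulr0.
rewrite -[quotmap _ _]/(QL _) linear_sum; apply: memv_suml => g _.
rewrite linearZ /=; apply: memvZ; rewrite -[quotmap _ _]/(wedge _).
have [/injectiveP gI|/injectivePn[i [j ij gij]]] := boolP (injectiveb g).
  rewrite (wedge_eq (v' := b \o perm gI)) ?wedge_perm // => i /=.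
  by rewrite permE.
by rewrite (wedge_alt ij) ?mem0v // gij.
Qed.

End TopExteriorPower.

Lemma dim_dualspace (k : fieldType) (V : vectType k) :
  \dim {: dualspace V} = \dim {:V}.
Proof. by rewrite !dimvf /dim /= muln1. Qed.

Lemma dim_tens (k : fieldType) (V V' : vectType k) :
  \dim {: tens V V'} = (\dim {:V} * \dim {:V'})%N.
Proof. by rewrite dimvf. Qed.

(** * The matroid of a representation *)

Section Represented.
Context {k : fieldType} {U W : vectType k} {S : finType}.
Variables (e : S -> U) (phi : 'Hom(U, W)).
Implicit Types (I J X Y A C : {set S}).
Local Notation M := (rep_matroid e phi).
Let v (i : S) : W := phi (e i).

Lemma indep_rep I : indep M I = (nul v I == 0%N).
Proof.
rewrite /= /free size_map -cardE -[<<_>>%VS]/(sp v I).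
have := nulE v I => nI; apply/eqP/eqP; lia.
Qed.

Lemma rank_rep X : rank M X = \dim (sp v X).
Proof.
have [I [iI sI rI]] := rank_basis M X.
have nI : nul v I = 0%N by apply/eqP; rewrite -indep_rep.
have -> : sp v X = sp v I.
  apply/eqP; rewrite eqEsubv (spS v sI) andbT; apply/sp_subP => x xX.
  have [xI|xI] := boolP (x \in I); first exact: mem_sp.
  apply: contraT => vx; have ixI : indep M (x |: I).
    by rewrite indep_rep nulU1 // nI (negbTE vx).
  have := indep_rank ixI (X := X); rewrite rI cardsU1 xI add1n ltnn; apply.
  by rewrite subUset sub1set xX.
by have := nulE v I; rewrite nI addn0 rI.
Qed.

Lemma circuit_cyclic C : circuit M C -> cyclic v C.
Proof.
case/and3P=> _ dC /forallP prC; apply/cyclicP => x xC; apply: contraR dC => vx.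
have /implyP/(_ (properD1 xC)) := prC (C :\ x); rewrite !indep_rep => /eqP nC.
by rewrite -(setD1K xC) nulU1 ?setD11 // nC (negbTE vx).
Qed.

(** An element that depends on the rest of [A] lies in the circuit formed with a
    minimal set of elements that span it. *)
Lemma cyclic_mem_circuit A x : cyclic v A -> x \in A ->
  exists C, [/\ circuit M C, C \subset A & x \in C].
Proof.
move=> /cyclicP cA xA; pose Q I := (I \subset A :\ x) && (v x \in sp v I).
have QA : Q (A :\ x) by rewrite /Q subxx cA.
case: (arg_minnP (fun I : {set S} => #|I|) QA) => I /andP[sI vI] minI.
have minD y : y \in I -> v x \notin sp v (I :\ y).
  move=> yI; apply/negP => vx; have := minI (I :\ y).
  rewrite /Q (subset_trans (subsetDl _ _) sI) vx (cardsD1 y I) yI add1n ltnn.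
  by move=> /(_ isT).
have xI : x \notin I by move: sI; rewrite subsetD1 => /andP[].
have nI : nul v I = 0%N.
  apply/eqP; apply: contraT => /nul_dependent[y yI vy].
  by have := minD y yI; rewrite (_ : sp v (I :\ y) = sp v I) ?vI //
     -[in RHS](setD1K yI) spU1_id.
exists (x |: I); split; last exact: setU11; last first.
  by rewrite subUset sub1set xA (subset_trans sI) // subsetDl.
rewrite /circuit subsetT indep_rep nulU1 // vI nI andTb.
apply/forallP => J; apply/implyP => /properP[sJ [y yxI yJ]].
rewrite indep_rep -leqn0.
have [yx|yx] := eqVneq y x.
  rewrite -nI; apply: nulS; apply/subsetP => z zJ; have := subsetP sJ z zJ.
  by rewrite !inE => /predU1P[zx|//]; rewrite -yx in zx; rewrite -zx zJ in yJ.
have yI : y \in I by move: yxI; rewrite !inE (negbTE yx).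
apply: leq_trans (nulS v (J := x |: (I :\ y)) _) _.
  apply/subsetP => z zJ; have := subsetP sJ z zJ; rewrite !inE.
  by case: (z == x) => //= ->; rewrite andbT; apply: contraNneq yJ => <-.
rewrite nulU1; last by rewrite !inE (negbTE xI) andbF.
by rewrite (negbTE (minD y yI)) -nI nulS // subsetDl.
Qed.

Lemma tflat_cyclic A : tflat M A = (A != set0) && cyclic v A.
Proof.
rewrite /tflat; congr (_ && _); apply/existsP/idP => [[P /andP[/forall_inP cP /eqP->]]|cA].
  apply/cyclicP => x /bigcupP[C CP xC].
  have /cyclicP/(_ x xC) := circuit_cyclic (cP C CP).
  by apply: mem_spS; apply/setSD/bigcup_sup.
exists [set C | circuit M C && (C \subset A)]; apply/andP; split.
  by apply/forall_inP => C; rewrite inE => /andP[].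
rewrite eqEsubset; apply/andP; split; apply/subsetP => x.
  move=> xA; have [C [cC sC xC]] := cyclic_mem_circuit cA xA.
  by apply/bigcupP; exists C; rewrite // inE cC.
by case/bigcupP=> C; rewrite inE => /andP[_ /subsetP sC] /sC.
Qed.

(** The rank of [X] in the dual is the nullity of [A] minus that of [A \ X]. *)
Lemma beta_dual_restrict A : A != set0 -> cyclic v A ->
  beta (dual (restrict M A)) = crapo v A.
Proof.
move=> A0 cA; set N := dual _.
have gN : ground N = A by rewrite /= setTI.
have rA X : X \subset A -> rank (restrict M A) X = \dim (sp v X).
  by move=> sX; rewrite rank_restrict // rank_rep.
have rN X : X \subset A -> (rank N X + nul v (A :\: X) = nul v A)%N.
  move=> sX; have := @rank_dual _ (restrict M A) X.
  rewrite -[ground (restrict M A)]/(ground N) gN => /(_ sX).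
  rewrite !rA ?subsetDl // -/N; have := nulE v (A :\: X); have := nulE v A.
  by have := cardsID X A; rewrite (setIidPr sX); lia.
rewrite beta_subsets gN; last first.
  move=> x xA; have := rN [set x]; rewrite sub1set (cyclic_nulD1 cA xA).
  by move=> /(_ xA); lia.
rewrite (reindex_onto (fun Y => A :\: Y) (fun X => A :\: X)) /=; last first.
  by move=> X sX; rewrite setDDr setDv set0U; apply/setIidPr.
rewrite (eq_bigl (fun Y : {set S} => Y \subset A)); last first.
  move=> Y; rewrite subsetDl /= setDDr setDv set0U; apply/eqP/idP => [<-|/setIidPr//].
  exact: subsetIl.
rewrite (eq_bigr (fun Y : {set S} => (-1) ^+ #|A| *
    ((-1) ^+ #|Y| * (nul v A)%:Z - (-1) ^+ #|Y| * (nul v Y)%:Z))); last first.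
  move=> Y sY; rewrite -mulrBr mulrA; congr (_ * _); last first.
    have := rN _ (subsetDl A Y).
    rewrite setDDr setDv set0U (setIidPr sY) => <-; rewrite PoszD addrK //.
  rewrite -signr_odd cardsD (setIidPr sY) oddB ?subset_leq_card // signr_addb.
  by rewrite !signr_odd.
rewrite -mulr_sumr sumrB -mulr_suml sum_subset_sign // mul0r sub0r.
rewrite mulrA mulrN -mulNr /crapo; congr (_ * _).
have := rN A (subxx A); rewrite setDv nul_set0 addn0 => ->.
rewrite -(nulE v A) exprD mulrCA -exprD addnn -mul2n exprM sqrrN !expr1n mulr1.
by rewrite exprS mulN1r.
Qed.

End Represented.

(** * The multiplicity space *)

Section Chains.
Context {k : fieldType} {W : vectType k} {S : finType}.
Implicit Types (v : S -> W) (A : {set S}).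

Lemma chain_sub (J : nat -> {set S}) l :
  (forall i, (i < l)%N -> J i \subset J i.+1) ->
  forall i, (i <= l)%N -> J i \subset J l.
Proof.
elim: l => [|l IH] sJ i; first by rewrite leqn0 => /eqP->.
rewrite leq_eqVlt => /predU1P[->//|il]; apply: subset_trans (sJ l (ltnSn l)).
by apply: IH => // j jl; apply/sJ/ltnW.
Qed.

Lemma chain_flagprod v (J : nat -> {set S}) (w : nat -> W) l :
    (forall i, (i <= l)%N -> cyclic v (J i) /\ nul v (J i) = i.+1) ->
    (forall i, (i < l)%N -> [/\ J i \subset J i.+1,
       w i \in sp v (J i.+1 :\: J i) & w i \in sp v (J i)]) ->
  flagprod v (J l) l (\prod_(i < l) linform (w i)).
Proof.
elim: l => [|l IH] cJ sJ.
  by rewrite big_ord0; have [c0 n0] := cJ 0%N isT; apply: FlagCircuit.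
rewrite big_ord_recr /=; have [c n] := cJ l.+1 (leqnn _).
have [s w1 w2] := sJ l (ltnSn _); apply: (@FlagStep _ _ _ _ _ (J l)) => //.
by apply: IH => i il; [apply: cJ; apply: leqW | apply: sJ; apply: ltnW].
Qed.

Lemma flagprod_chain v A l p : flagprod v A l p ->
  exists (J : nat -> {set S}) (w : nat -> W), [/\ J l = A,
    (forall i, (i <= l)%N -> cyclic v (J i) /\ nul v (J i) = i.+1),
    (forall i, (i < l)%N -> [/\ J i \subset J i.+1,
       w i \in sp v (J i.+1 :\: J i) & w i \in sp v (J i)])
    & p = \prod_(i < l) linform (w i)].
Proof.
elim=> {A l p} [A cA nA|A J' l p w' _ [J [w [Jl cJ sJ ->]]] sA cA nA w1 w2].
  exists (fun=> A), (fun=> 0); split=> // [[]|] //.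
  by rewrite big_ord0.
exists (fun i => if (i <= l)%N then J i else A).
exists (fun i => if (i < l)%N then w i else w').
split=> [|i|i|].
- by rewrite ltnn.
- rewrite leq_eqVlt ltnS => /predU1P[->|il]; first by rewrite ltnn.
  by rewrite il; apply: cJ.
- rewrite ltnS => il'; have /predU1P[->|il] : (i == l) || (i < l)%N.
    by rewrite -leq_eqVlt.
  by rewrite ltnn leqnn Jl.
  by rewrite il ltnW //; apply: sJ.
- rewrite big_ord_recr /= ltnn; congr (_ * _); apply: eq_bigr => i _.
  by rewrite ltn_ord.
Qed.

Lemma lowdeg_span v A l (s : seq (sympow W l)) :
  (forall p : sympow W l, p \in s -> lowdeg v A (val p)) ->
  forall p : sympow W l, p \in <<s>>%VS -> lowdeg v A (val p).
Proof.
elim: s => [|q s IH] hs p.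
  by rewrite span_nil memv0 => /eqP-> eta; rewrite rmorph0 size_poly0.
rewrite span_cons => /memv_addP[_ /vlineP[c ->] [p' p's ->]] eta.
have -> : val (c *: q + p') = c *: val q + val p' by [].
rewrite rmorphD /= shiftZ.
apply: leq_trans (size_polyD _ _) _; rewrite geq_max; apply/andP; split.
  apply: leq_trans (size_scale_leq _ _) _; apply: hs; exact: mem_head.
by apply: IH => // x xs; apply: hs; rewrite inE xs orbT.
Qed.

End Chains.

(** The multiplicity space of [A] lives in a symmetric power of the span of [A],
    so the configuration is moved from [W] into that span. Vectors outside the
    span are sent to arbitrary values. *)
Section Ambient.
Context {k : fieldType} {W : vectType k} {S : finType}.
Variables (v : S -> W) (A : {set S}).
Implicit Types Y : {set S}.

Definition restr_vec (i : S) : subvs_of (sp v A) := vsproj (sp v A) (v i).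

Lemma sp_restr Y : Y \subset A -> sp v Y = (linfun vsval @: sp restr_vec Y)%VS.
Proof.
move=> sY; rewrite /sp limg_span -map_comp; congr (<<_>>)%VS.
apply/eq_in_map => i /=; rewrite mem_enum => iY; rewrite lfunE /= vsprojK //.
by apply: mem_sp; apply: (subsetP sY).
Qed.

Lemma mem_sp_restr Y (w : subvs_of (sp v A)) : Y \subset A ->
  (w \in sp restr_vec Y) = (vsval w \in sp v Y).
Proof.
move=> sY; rewrite (sp_restr sY).
apply/idP/memv_imgP => [wY|[u uY]]; first by exists w; rewrite ?lfunE.
by rewrite lfunE /= => /val_inj->.
Qed.

Lemma dim_sp_restr Y : Y \subset A -> \dim (sp restr_vec Y) = \dim (sp v Y).
Proof.
move=> sY; rewrite (sp_restr sY).
rewrite limg_dim_eq //; apply/eqP; rewrite -subv0; apply/subvP => w.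
rewrite memv_cap memv_ker lfunE memv0 => /andP[_ /eqP w0].
by apply/eqP/val_inj.
Qed.

Lemma nul_restr Y : Y \subset A -> nul restr_vec Y = nul v Y.
Proof. by move=> sY; rewrite /nul dim_sp_restr. Qed.

Lemma cyclic_restr Y : Y \subset A -> cyclic restr_vec Y = cyclic v Y.
Proof.
move=> sY; apply: eq_forallb_in => x xY.
rewrite mem_sp_restr ?(subset_trans (subsetDl _ _)) // vsprojK //.
by apply: mem_sp; apply: (subsetP sY).
Qed.

Lemma crapo_restr : crapo restr_vec A = crapo v A.
Proof.
rewrite /crapo dim_sp_restr //; congr (_ * _); apply: eq_bigr => Y sY.
by rewrite nul_restr.
Qed.

End Ambient.

Section MultiplicitySpace.
Context {k : fieldType} {U W : vectType k} {S : finType}.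
Variables (e : S -> U) (phi : 'Hom(U, W)).
Let v (i : S) : W := phi (e i).
Local Notation M := (rep_matroid e phi).

Lemma tflat_level A i : tflat M A /\ level e phi A = i <->
  cyclic v A /\ nul v A = i.+1.
Proof.
have lE : level e phi A = (nul v A).-1 by rewrite -subn1.
rewrite tflat_cyclic lE; split=> [[/andP[/set0Pn[a aA] cA] <-]|[cA nA]].
  by split=> //; rewrite (cyclic_nulD1 cA aA).
by rewrite cA nA; split=> //; rewrite andbT; apply: contra_eqN nA => /eqP->; rewrite nul_set0.
Qed.

Lemma dim_mult_space A : tflat M A -> (\dim (mult_space e phi A))%:Z = crapo v A.
Proof.
move=> tA; rewrite -crapo_restr; set l := level e phi A.
have [cA nA] : cyclic v A /\ nul v A = l.+1 by apply/tflat_level.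
apply: (@dim_flag_space _ _ _ (restr_vec v A) A l (mult_space e phi A)).
- by rewrite cyclic_restr.
- by rewrite nul_restr.
- move=> p /flagprod_chain[J [w [Jl cJ sJ pE]]]; rewrite /mult_space tA.
  have sJA i : (i <= l)%N -> J i \subset A.
    by rewrite -Jl; apply: chain_sub => j /sJ[].
  apply: mem_linspan; exists J, (fun i => w i); split.
  + split=> // i il; last first.
      have [sJi _ _] := sJ i il; rewrite properEneq sJi andbT.
      have [_ n1] := cJ i (ltnW il); have [_ n2] := cJ i.+1 il.
      by apply/eqP => eJ; move: n2; rewrite -eJ n1 => /n_Sn.
    apply/tflat_level; have [] := cJ i il.
    by rewrite cyclic_restr ?nul_restr // sJA.
  + move=> i; have [_ w1 w2] := sJ i (ltn_ord i).
    rewrite memv_cap; move: w1 w2; rewrite !mem_sp_restr; last 2 first.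
    * by apply: sJA; apply: ltnW.
    * by apply: subset_trans (subsetDl _ _) _; apply: sJA.
    by move=> -> ->.
  + exact: val_inj.
move=> p; rewrite /mult_space tA => /linspanP[s [sP ps]].
apply: lowdeg_span ps => q /sP[J [w [[Jl tJ sJ] wJ ->]]].
have sJA i : (i <= l)%N -> J i \subset A.
  by rewrite -Jl; apply: chain_sub => j /sJ/proper_sub.
have cJ i : (i <= l)%N -> cyclic (restr_vec v A) (J i) /\ nul (restr_vec v A) (J i) = i.+1.
  by move=> il; rewrite cyclic_restr ?nul_restr ?sJA //; apply/tflat_level/tJ.
pose w' (i : nat) := if insub i is Some j then w j else 0.
have wE (i : 'I_l) : w' i = w i by rewrite /w' valK.
apply: (@flagprod_lowdeg _ _ _ _ _ l); rewrite /= -[X in flagprod _ X]Jl.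
rewrite (eq_bigr (fun i : 'I_l => linform (w' i))) => [|i _]; last by rewrite wE.
apply: chain_flagprod => // i il.
have := wJ (Ordinal il); rewrite memv_cap -wE /= => /andP[w1 w2].
split; first exact: proper_sub (sJ i il).
  rewrite mem_sp_restr //; apply: subset_trans (subsetDl _ _) _; exact: sJA.
by rewrite mem_sp_restr // sJA // ltnW.
Qed.

End MultiplicitySpace.

Theorem theorem3p6 (k : fieldType) (U W : vectType k) (S : finType)
    (e : S -> U) (e_basis : basis_of {:U}%VS (codom e)) (phi : 'Hom(U, W))
    (A : {set S}) (A_tflat : tflat (rep_matroid e phi) A) :
  (\dim {: T_space e phi A}%VS)%:Z
    = beta (dual (restrict (rep_matroid e phi) A)).
Proof.
have dimU : #|A| = \dim {: subvs_of (Usp e A)}.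
  have nS : nul e [set: S] = 0%N.
    have /basis_free/eqP fe := e_basis.
    have -> : nul e [set: S] = (#|S| - \dim <<codom e>>)%N.
      by rewrite /nul cardsT /sp /codom /image_mem enum_setT -enumT.
    by rewrite fe size_codom subnn.
  have nA : nul e A = 0%N by apply/eqP; rewrite -leqn0 -nS nulS ?subsetT.
  by rewrite dim_subvs -[LHS](nulE e A) nA addn0.
have dimV : rk e phi A = \dim {: dualspace (subvs_of (Vsp e phi A))}.
  by rewrite dim_dualspace dim_subvs.
rewrite /T_space !dim_tens (dim_extpow_top dimU) (dim_extpow_top dimV) !muln1.
rewrite dim_dualspace dim_subvs dim_mult_space //.
by move: A_tflat; rewrite tflat_cyclic => /andP[A0 cA]; rewrite beta_dual_restrict.
Qed.
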